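(* Let $\mathsf T$ be a tiling of a marked disc with an open tile of length at least two. Let $k$ be the maximum length of an open tile of $\mathsf T$, and let $A_{\mathsf T}$ be the tiling algebra associated to $\mathsf T$. Then the Gorenstein dimension of $A_{\mathsf T}$ is $k-1$.
   Context: Let $\mathcal{P}$ be a disc with at least two marked points on its boundary. A tiling $\mathsf T$ of $\mathcal P$ is a collection of distinct, pairwise noncrossing interior diagonals (arcs joining two distinct marked points, determined by their endpoints; interior arcs joining neighbouring marked points are allowed); the regions they cut out are the tiles. The length of a tile is the number of interior diagonals of $\mathsf T$ bounding it. A tile is closed if it is bounded only by interior diagonals, and open if its boundary also contains a piece of the boundary of $\mathcal P$. Tiling algebras are assumed connected; in particular every open tile has exactly one open boundary (one connected boundary segment on the boundary of $\mathcal P$). The tiling algebra $A_{\mathsf T}=\mathbf{k}Q_{\mathsf T}/\mathsf I_{\mathsf T}$ ($\mathbf k$ an algebraically closed field): vertices of $Q_{\mathsf T}$ are the interior diagonals; there is an arrow $\alpha\to\beta$ whenever $\alpha,\beta$ share a marked point $x$, belong to the same tile, and the rotation with minimal angle around $x$ sending $\alpha$ to $\beta$ is clockwise; $\mathsf I_{\mathsf T}$ is generated by the compositions of two successive arrows coming from the same tile. $A_{\mathsf T}$ is a gentle algebra, and a gentle algebra has finite injective dimension both as a left and as a right module over itself; this common dimension is its Gorenstein dimension. *)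

(* Defs.v *)
From HB Require Import structures.
From mathcomp Require Import all_boot all_order all_algebra.
From mathcomp Require Import boolp functions.

Set Implicit Arguments.
Unset Strict Implicit.
Unset Printing Implicit Defensive.

Import GRing.Theory.
Local Open Scope ring_scope.
Local Open Scope quotient_scope.

(* The marked points are 0, ..., n.-1, numbered counterclockwise around the
   boundary of the disc; the boundary segment i : 'I_n joins the marked point i
   to the next one counterclockwise. A diagonal is determined by its endpoints
   and is encoded as the 2-element set of these. It is always an interior arc,
   even when its endpoints are neighbours: such a diagonal cuts out a region
   containing a single boundary segment. *)
Section Tilings.

Variable n : nat.
Implicit Types (a b i x y z : 'I_n) (d : {set 'I_n}).
Implicit Types (T : {set {set 'I_n}}).

(* Travelling counterclockwise from a, one meets b strictly before c. *)
Definition ccw a b c : bool :=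
  [|| (a < b < c)%N, (b < c < a)%N | (c < a < b)%N].

Definition crossing d1 d2 : bool :=
  [exists a, exists b, exists x, exists y,
    [&& d1 == [set a; b], d2 == [set x; y], ccw a x b & ccw b y a]].

Definition is_tiling T : bool :=
  [forall d1 in T, (#|d1| == 2) && [forall d2 in T, ~~ crossing d1 d2]].

(* Each diagonal of T has two sides, i.e. it bounds two half-discs. The side
   (a, b) of the diagonal {a, b} is the half-disc whose boundary runs
   counterclockwise from a to b. *)
Definition sides T : {set 'I_n * 'I_n} := [set s | [set s.1; s.2] \in T].

Definition diagonal_of (s : 'I_n * 'I_n) : {set 'I_n} := [set s.1; s.2].

(* The boundary segments of the half-disc s; the complement of [segments s] is
   the set of boundary segments of the opposite side (s.2, s.1). Half-discs cut
   out by noncrossing diagonals are included in one another if and only if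
   their sets of boundary segments are. *)
Definition segments (s : 'I_n * 'I_n) : {set 'I_n} :=
  [set i | (i == s.1) || ccw s.1 i s.2].

(* For s and t on two different diagonals: s and t face each other, i.e. the
   complementary half-disc of s is contained in t, and no diagonal of T
   separates the two diagonals. *)
Definition adjacent_region T (s t : 'I_n * 'I_n) : bool :=
  (~: segments s \proper segments t) &&
  [forall u in sides T,
     ~~ ((~: segments s \proper segments u) && (segments u \proper segments t))].

(* A tile (a region cut out by T) is encoded as the set of all the sides of
   diagonals that bound it; [tile_at T s] is the tile that lies next to the
   diagonal of s, in the half-disc s. As soon as T is nonempty, all regions
   arise in this way. *)
Definition tile_at T (s : 'I_n * 'I_n) : {set 'I_n * 'I_n} :=
  [set t in sides T | (t == s) || adjacent_region T s t].

Definition tiles T : {set {set 'I_n * 'I_n}} := [set tile_at T s | s in sides T].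

Implicit Type t : {set 'I_n * 'I_n}.

Definition bounds d t : bool := [exists s in t, d == diagonal_of s].

Definition tile_length t : nat := #|[set d | bounds d t]|.

(* The tile t is the intersection of the half-discs s \in t, so i below is a
   boundary segment of the disc lying on the boundary of t. *)
Definition open_tile t : bool := [exists i, [forall s in t, i \in segments s]].

Definition max_open_length T : nat :=
  \max_(t in tiles T | open_tile t) tile_length t.

(* At a marked point x on the boundary, the rotation with minimal angle (inside
   the tile) sending {x, y} to {x, z} is clockwise iff z comes before y when
   travelling counterclockwise from x. *)
Definition arrow_in t d1 d2 : bool :=
  [exists x, exists y, exists z,
    [&& d1 == [set x; y], d2 == [set x; z], ccw x z y, bounds d1 t
      & bounds d2 t]].

Definition quiver_vertex T : finType := {d : {set 'I_n} | d \in T}.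

(* Two distinct diagonals share at most one marked point, and there is then at
   most one tile having a corner there bounded by both: the quiver has no
   multiple arrows. *)
Definition quiver_arrow T (v w : quiver_vertex T) : bool :=
  [exists t in tiles T, arrow_in t (val v) (val w)].

Definition same_tile_composition T (u v w : quiver_vertex T) : bool :=
  [exists t in tiles T,
    arrow_in t (val u) (val v) && arrow_in t (val v) (val w)].

End Tilings.

(* A quiver without multiple arrows is given by a relation e on its vertices. A
   path is a pair (v, p) with [path e v p]: it starts at v and then visits the
   vertices in p. An element of the path algebra kQ is a finitely supported
   function on paths. As the set of vertices is finite, this means that there
   is a bound on the length of the paths of the support. *)
Definition path_fun (K : fieldType) (V : finType) (e : rel V) : Type :=
  V * seq V -> K.

Section PathFunctions.

Variables (K : fieldType) (V : finType) (e : rel V).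
Local Notation pf := (path_fun K e).

HB.instance Definition _ := GRing.Zmodule.copy pf (V * seq V -> K).

Definition path_fun_one : pf := fun p => (p.2 == [::])%:R.

(* The bilinear extension of the concatenation of paths: (v, p) factors as
   (v, take i p) followed by (last v (take i p), drop i p). *)
Definition path_fun_mul (f g : pf) : pf := fun p =>
  \sum_(i < (size p.2).+1)
     f (p.1, take i p.2) * g (last p.1 (take i p.2), drop i p.2).

Lemma path_fun_mulA : associative path_fun_mul.
Proof.
move=> f g h; apply/funext => -[v p]; rewrite /path_fun_mul /=.
set N := size p.
pose F (j i : nat) : K := f (v, take j p) *
  (g (last v (take j p), take (i - j) (drop j p)) *
   h (last v (take i p), drop i p)).
transitivity (\sum_(0 <= j < N.+1) \sum_(0 <= i < N.+1 | (j <= i)%N) F j i).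
  rewrite -(big_mkord xpredT (fun j => f (v, take j p) *
     path_fun_mul g h (last v (take j p), drop j p))).
  rewrite big_nat [RHS]big_nat; apply: eq_bigr => j /andP[_ jN].
  rewrite /path_fun_mul /= mulr_sumr size_drop -/N.
  rewrite -(big_mkord xpredT (fun i => f (v, take j p) *
    (g (last v (take j p), take i (drop j p)) *
     h (last (last v (take j p)) (take i (drop j p)), drop i (drop j p))))).
  rewrite [RHS]big_mkcond /= [RHS](@big_cat_nat _ _ _ j) //=; last exact: ltnW.
  have -> : \sum_(0 <= i < j) (if (j <= i)%N then F j i else 0) = 0.
    by rewrite big_nat big1 // => i /andP[_ ij]; rewrite leqNgt ij.
  rewrite add0r.
  rewrite [RHS](big_addn 0 N.+1 j xpredT (fun i => if (j <= i)%N then F j i else 0)).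
  rewrite subSn //.
  apply: eq_bigr => i _; rewrite leq_addl /F addnK -last_cat -takeD drop_drop.
  by rewrite [(j + i)%N]addnC.
rewrite (exchange_big_dep_nat xpredT) //=.
rewrite -(big_mkord xpredT (fun i =>
  path_fun_mul f g (v, take i p) * h (last v (take i p), drop i p))).
rewrite big_nat [RHS]big_nat; apply: eq_bigr => i /andP[_ iN].
rewrite /path_fun_mul /= mulr_suml size_takel //.
rewrite -(big_mkord xpredT (fun j => f (v, take j (take i p)) *
  g (last v (take j (take i p)), drop j (take i p)) *
  h (last v (take i p), drop i p))).
rewrite big_mkcond /= (@big_cat_nat _ _ _ i.+1) //=.
have -> : \sum_(i.+1 <= j < N.+1) (if (j <= i)%N then F j i else 0) = 0.
  by rewrite big_nat big1 // => j /andP[ij _]; rewrite leqNgt ij.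
rewrite addr0.
rewrite big_nat [RHS]big_nat; apply: eq_bigr => j /andP[_ ji].
rewrite ltnS in ji; rewrite ji /F mulrA; congr (_ * _ * _).
  by rewrite take_takel.
by rewrite take_takel // take_drop subnK.
Qed.

Lemma path_fun_mul1l : left_id path_fun_one path_fun_mul.
Proof.
move=> f; apply/funext => -[v p]; rewrite /path_fun_mul big_ord_recl /=.
rewrite /path_fun_one take0 /= mul1r drop0 big1 ?addr0 // => i _.
by case: p i => [|w p] [i] //= ip; rewrite mul0r.
Qed.

Lemma path_fun_mul1r : right_id path_fun_one path_fun_mul.
Proof.
move=> f; apply/funext => -[v p]; rewrite /path_fun_mul big_ord_recr /=.
rewrite /path_fun_one take_size drop_size eqxx mulr1 big1 ?add0r // => i _ /=.
by rewrite -size_eq0 size_drop subn_eq0 leqNgt ltn_ord mulr0.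
Qed.

Lemma path_fun_mulDl : left_distributive path_fun_mul +%R.
Proof.
move=> f g h; apply/funext => p.
rewrite [RHS](_ : _ = path_fun_mul f h p + path_fun_mul g h p) //.
by rewrite /path_fun_mul -big_split; apply: eq_bigr => i _; apply: mulrDl.
Qed.

Lemma path_fun_mulDr : right_distributive path_fun_mul +%R.
Proof.
move=> f g h; apply/funext => p.
rewrite [RHS](_ : _ = path_fun_mul f g p + path_fun_mul f h p) //.
by rewrite /path_fun_mul -big_split; apply: eq_bigr => i _; apply: mulrDr.
Qed.

HB.instance Definition _ := GRing.Zmodule_isPzRing.Build pf
  path_fun_mulA path_fun_mul1l path_fun_mul1r path_fun_mulDl path_fun_mulDr.

Definition path_algebra_pred (f : pf) : bool :=
  `[< (forall v p, f (v, p) != 0 -> path e v p) /\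
      (exists N, forall v p, (N <= size p)%N -> f (v, p) = 0) >].

Lemma path_fun_subE (f g : pf) p : (f - g) p = f p - g p.
Proof. by []. Qed.

Lemma path_algebra_subring : subring_closed path_algebra_pred.
Proof.
split.
- apply/asboolP; split.
    by move=> v [|w p] //; rewrite /1 /= /path_fun_one /= eqxx.
  by exists 1%N => v [|w p].
- move=> f g /asboolP[fp [Nf fN]] /asboolP[gp [Ng gN]].
  apply/asboolP; split=> [v p|].
    rewrite path_fun_subE.
    have [f0|/fp//] := eqVneq (f (v, p)) 0.
    have [g0|/gp//] := eqVneq (g (v, p)) 0.
    by rewrite f0 g0 subrr eqxx.
  exists (maxn Nf Ng) => v p; rewrite geq_max => /andP[/fN fv /gN gv].
  by rewrite path_fun_subE fv gv subrr.
- move=> f g /asboolP[fp [Nf fN]] /asboolP[gp [Ng gN]].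
  apply/asboolP; split=> [v p|].
    apply: contraR => np; apply/eqP/big1 => i _ /=.
    have [->|/fp pf] := eqVneq (f (v, take i p)) 0; first by rewrite mul0r.
    have [->|/gp pg] := eqVneq (g (last v (take i p), drop i p)) 0.
      by rewrite mulr0.
    by case/negP: np; rewrite -[X in path _ _ X](cat_take_drop i) cat_path pf pg.
  exists (Nf + Ng)%N => v p Np; apply: big1 => i _ /=.
  have ip : (i <= size p)%N by rewrite -ltnS.
  have [fi|ifN] := leqP Nf i.
    by rewrite fN ?mul0r // size_takel.
  rewrite gN ?mulr0 // size_drop.
  by rewrite leq_subRL // (leq_trans _ Np) // leq_add2r ltnW.
Qed.

Record path_algebra :=
  PathAlgebra { path_coef :> pf; _ : path_algebra_pred path_coef }.

HB.instance Definition _ := [isSub for path_coef].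
HB.instance Definition _ := [Choice of path_algebra by <:].
HB.instance Definition _ :=
  GRing.SubChoice_isSubPzRing.Build pf path_algebra_pred path_algebra
    path_algebra_subring.

(* The element x of kQ is the path that starts at v and visits p. *)
Definition is_path_element (v : V) (p : seq V) (x : path_algebra) : Prop :=
  path e v p /\ forall q, path_coef x q = (q == (v, p))%:R.

End PathFunctions.

Section IdealQuotients.

Variable R : pzRingType.

Definition two_sided_ideal (J : R -> Prop) : Prop :=
  [/\ J 0, forall x y, J x -> J y -> J (x + y)
    & forall a x, J x -> J (a * x) /\ J (x * a)].

Definition generated_ideal (X : R -> Prop) (x : R) : bool :=
  `[< forall J, two_sided_ideal J -> (forall y, X y -> J y) -> J x >].

Variable X : R -> Prop.

Lemma generated_ideal_zmod : zmod_closed (generated_ideal X).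
Proof.
split=> [|x y /asboolP Ix /asboolP Iy]; apply/asboolP => J idJ XJ.
  by case: idJ.
have [_ JD JM] := idJ; apply: JD; first exact: Ix.
by rewrite -mulN1r; apply: (JM _ _ _).1; apply: Iy.
Qed.

HB.instance Definition _ :=
  GRing.isZmodClosed.Build R (generated_ideal X) generated_ideal_zmod.

Lemma generated_idealM (a x : R) : x \in generated_ideal X ->
  (a * x \in generated_ideal X) /\ (x * a \in generated_ideal X).
Proof.
move=> /asboolP Ix; split; apply/asboolP => J idJ XJ;
  by have [_ _ JM] := idJ; case: (JM a x (Ix J idJ XJ)).
Qed.

Definition ideal_quotient : Type :=
  Quotient.quot (GRing.ZmodClosed.clone R (generated_ideal X) _).

HB.instance Definition _ := GRing.Zmodule.on ideal_quotient.
HB.instance Definition _ := EqQuotient.on ideal_quotient.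

Local Notation toQ := (\pi_ideal_quotient).

Definition quotient_one : ideal_quotient := toQ 1.

Definition quotient_mul (x y : ideal_quotient) : ideal_quotient :=
  toQ (repr x * repr y).

Lemma quotient_piM (x y : R) : quotient_mul (toQ x) (toQ y) = toQ (x * y).
Proof.
have reprP z : repr (toQ z) - z \in generated_ideal X.
  by rewrite Quotient.idealrBE reprK.
apply/eqP; rewrite /quotient_mul -Quotient.idealrBE.
have -> : repr (toQ x) * repr (toQ y) - x * y =
    repr (toQ x) * (repr (toQ y) - y) + (repr (toQ x) - x) * y.
  by rewrite mulrBr mulrBl addrA subrK.
by apply: rpredD; [apply: (generated_idealM _ _).1
                  |apply: (generated_idealM _ _).2]; exact: reprP.
Qed.

Lemma quotient_piD (x y : R) : toQ x + toQ y = toQ (x + y).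
Proof. by symmetry; apply: Quotient.pi_add. Qed.

Lemma quotient_mulA : associative quotient_mul.
Proof.
move=> x y z; rewrite -[x]reprK -[y]reprK -[z]reprK.
move: (repr x) (repr y) (repr z) => a b c.
by rewrite (quotient_piM b c) (quotient_piM a b) !quotient_piM mulrA.
Qed.

Lemma quotient_mul1l : left_id quotient_one quotient_mul.
Proof. by move=> x; rewrite -[x]reprK quotient_piM mul1r. Qed.

Lemma quotient_mul1r : right_id quotient_one quotient_mul.
Proof. by move=> x; rewrite -[x]reprK quotient_piM mulr1. Qed.

Lemma quotient_mulDl : left_distributive quotient_mul +%R.
Proof.
move=> x y z; rewrite -[x]reprK -[y]reprK -[z]reprK.
move: (repr x) (repr y) (repr z) => a b c.
rewrite quotient_piD (quotient_piM a c) (quotient_piM b c) quotient_piM.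
by rewrite quotient_piD mulrDl.
Qed.

Lemma quotient_mulDr : right_distributive quotient_mul +%R.
Proof.
move=> x y z; rewrite -[x]reprK -[y]reprK -[z]reprK.
move: (repr x) (repr y) (repr z) => a b c.
rewrite quotient_piD (quotient_piM a b) (quotient_piM a c) quotient_piM.
by rewrite quotient_piD mulrDr.
Qed.

HB.instance Definition _ := GRing.Zmodule_isPzRing.Build ideal_quotient
  quotient_mulA quotient_mul1l quotient_mul1r quotient_mulDl quotient_mulDr.

End IdealQuotients.

Section TilingAlgebra.

Variables (K : closedFieldType) (n : nat) (T : {set {set 'I_n}}).

Local Notation kQ := (path_algebra K (@quiver_arrow n T)).

Definition tiling_relation (x : kQ) : Prop :=
  exists u v w : quiver_vertex T,
    same_tile_composition u v w /\ is_path_element u [:: v; w] x.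

(* Only the ring structure of A_T = kQ / I is recorded: modules, injective
   dimensions and connectedness do not depend on anything else. *)
Definition tiling_algebra : Type := ideal_quotient tiling_relation.

HB.instance Definition _ := GRing.PzRing.on tiling_algebra.

End TilingAlgebra.

Definition connected_ring (R : pzRingType) : Prop :=
  (1 : R) <> 0 /\
  forall x : R, x * x = x -> (forall y : R, x * y = y * x) -> x = 0 \/ x = 1.

Definition injective_module (R : pzRingType) (E : lmodType R) : Prop :=
  forall (M N : lmodType R) (i : {linear M -> N}) (f : {linear M -> E}),
    injective i -> exists g : {linear N -> E}, forall x, g (i x) = f x.

(* An injective resolution 0 -> M -> E 0 -> E 1 -> ... with E i = 0 for
   i > m. *)
Definition has_injective_resolution (R : pzRingType) (M : lmodType R)
    (m : nat) : Prop :=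
  exists (E : nat -> lmodType R) (eta : {linear M -> E 0%N})
         (delta : forall i, {linear E i -> E i.+1}),
    [/\ injective eta /\ (forall x, delta 0%N x = 0 <-> exists y, eta y = x),
        forall i x, delta i.+1 x = 0 <-> exists y, delta i y = x,
        forall i, injective_module (E i)
      & forall i, (m < i)%N -> forall x : E i, x = 0].

Definition injective_dimension (R : pzRingType) (M : lmodType R)
    (m : nat) : Prop :=
  has_injective_resolution M m /\
  forall m', has_injective_resolution M m' -> (m <= m')%N.

(* A right R-module is a left module over the converse ring R^c. *)
Definition gorenstein_dimension (R : pzRingType) (m : nat) : Prop :=
  injective_dimension (R^o : lmodType R) m /\
  injective_dimension ((R^c)^o : lmodType R^c) m.

(* Main.v *)
From HB Require Import structures.
Require Import Defs.
From mathcomp Require Import all_boot all_order all_algebra zify.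
From mathcomp Require Import boolp functions.
From mathcomp Require classical_sets.

(* Cut every diagonal into its two half-edges (x, y) and (y, x). The half-edges
   at a marked point form a chain, and A_T is the ring of the matrices that are
   indexed by the half-edges, triangular along the chains, and have equal
   diagonal entries at the two half-edges of a diagonal. This description is
   symmetric under passing to the converse ring and reversing the chains, so
   that only left modules have to be considered.
   Upper bound. For a set A of half-edges, let J(A) be the left module of the
   K-linear functionals on A_T that only depend on the rows in A; it is
   injective when A is a union of diagonals. For h on a diagonal with half-edges
   h and h', there is an exact sequence 0 -> J{h} -> J{h, h'} -> J{p} -> 0,
   where p is the predecessor of h' in its chain (J{p} is to be read as 0 if h'
   is minimal). The regular module embeds in the product over h of the
   J{m, m'}, m being the maximum of the chain of h, and the cokernel is
   J(all) times the product of the J{p}, for p the predecessor of m'. Iterating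
   the first sequence amounts to walking around an open tile, starting from its
   open boundary, so the resolution stops after the longest such walk.
   Lower bound. Along a walk h_0, ..., h_(k-1) around an open tile the arrows
   h_j -> h_(j+1) define an exact complex of projective modules A_T e(h_j); a
   shorter injective resolution would force e(h_0) to be a multiple of the first
   arrow.
   Connectedness is needed to know that a single walk goes through all the
   sides of an open tile: otherwise a cut of the disc through the tile avoids
   all diagonals and defines a nontrivial central idempotent. *)

Set Implicit Arguments.
Unset Strict Implicit.
Unset Printing Implicit Defensive.

(** * Chains of half-edges *)

(* H is to be the set of half-edges: le orders those at a common marked point,
   and sg exchanges the two halves of a diagonal. *)
Record chain_gluing (H : finType) (sg : H -> H) (le : rel H) : Prop := {
  gluing_sgK : involutive sg;
  gluing_refl : reflexive le;
  gluing_anti : antisymmetric le;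
  gluing_trans : transitive le;
  gluing_down : forall u w h, le u h -> le w h -> le u w || le w u;
  gluing_up : forall u w h, le h u -> le h w -> le u w || le w u;
  gluing_sg : forall h, ~~ le h (sg h)
}.

Section GluedChains.

Variables (H : finType) (sg : H -> H) (le : rel H).
Hypothesis G : chain_gluing sg le.
Implicit Types (h u w p : H).

Let lexx h : le h h := gluing_refl G h.

Lemma sg_neq h : (sg h == h) = false.
Proof. by apply/negP => /eqP hh; have := gluing_sg G h; rewrite hh lexx. Qed.

Lemma neq_sg h : (h == sg h) = false.
Proof. by rewrite eq_sym sg_neq. Qed.

(** The down-set of [p] lies in that of [u], so the cardinals force equality. This turns a maximal
    number of elements below into maximality for [le]. *)
Lemma le_of_card p u :
  le p u -> (#|[pred w | le w u]| <= #|[pred w | le w p]|)%N -> le u p.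
Proof.
move=> pu card_le; have sub : [pred v | le v p] \subset [pred v | le v u].
  by apply/subsetP => v; rewrite !inE => vp; apply: (gluing_trans G vp).
have /eqP/subset_cardP/(_ sub)/(_ u) : #|[pred v | le v p]| == #|[pred v | le v
  u]|.
  by rewrite eqn_leq card_le subset_leq_card.
by rewrite !inE lexx.
Qed.

(** The lower element is the second argument. As down-sets are chains, asking [p] to dominate
    everything strictly below [h] excludes no immediate predecessor, and it makes uniqueness
    immediate. *)
Definition covers h p : bool :=
  [&& le p h, p != h & [forall u, le u h && (u != h) ==> le u p]].

Lemma covers_le h p : covers h p -> le p h.
Proof. by case/and3P. Qed.

Lemma covers_neq h p : covers h p -> p != h.
Proof. by case/and3P. Qed.

Lemma covers_max h p u : covers h p -> le u h -> u != h -> le u p.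
Proof. by case/and3P => _ _ /forallP /(_ u) /implyP c uh nuh;
  rewrite c ?uh. Qed.

Lemma covers_fun h p q : covers h p -> covers h q -> p = q.
Proof.
move=> hp hq; apply: (gluing_anti G).
by rewrite (covers_max hq) ?(covers_max hp) ?covers_le ?covers_neq.
Qed.

Definition chain_pred h : option H := [pick p | covers h p].

Lemma chain_predP h p : chain_pred h = Some p <-> covers h p.
Proof.
rewrite /chain_pred; case: pickP => [q hq|hN].
  by split=> [[<-]//|hp]; rewrite (covers_fun hq hp).
by split=> // hp; rewrite hN in hp.
Qed.

Lemma chain_pred_None h u : chain_pred h = None -> le u h -> u = h.
Proof.
rewrite /chain_pred; case: pickP => // hN _ uh; apply/eqP.
apply: contraFT (hN [arg max_(p > u | le p h && (p != h)) #|[pred w | le w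
  p]|]).
move=> nuh; case: arg_maxnP => [|p /andP[ph nph] pmax]; first by rewrite uh.
rewrite /covers ph nph; apply/forallP => w; apply/implyP => /andP[wh nwh].
have /orP[//|pw] := gluing_down G wh ph.
by apply: (le_of_card pw); apply: pmax; rewrite wh.
Qed.

Definition chain_max h : H := odflt h [pick m | le h m && [forall u, le m u ==>
  (u == m)]].

Lemma chain_maxP h :
  le h (chain_max h) /\ forall u, le (chain_max h) u -> u = chain_max h.
Proof.
rewrite /chain_max; case: pickP => [m /andP[hm /forallP mm]|hN] /=.
  by split=> // u mu; apply/eqP; have := mm u; rewrite mu.
suff [p hp pmax] : exists2 p, le h p &
    forall q, le h q -> (#|[pred w | le w q]| <= #|[pred w | le w p]|)%N.
  have := hN p; rewrite /= hp => /negP[]; apply/forallP => u;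
    apply/implyP => pu.
  apply/eqP/(gluing_anti G); rewrite pu andbT.
  by apply: (le_of_card pu); apply: pmax; apply: (gluing_trans G hp).
by case: (@arg_maxnP _ h (le h) (fun p => #|[pred w | le w p]|) (lexx h)) => p;
  exists p.
Qed.

Lemma chain_max_le h u : le h u -> le u (chain_max h).
Proof.
have [hm mm] := chain_maxP h => hu.
by have /orP[//|/mm ->] := gluing_up G hu hm; exact: lexx.
Qed.

End GluedChains.

Section Walks.

Variables (H : finType) (sg : H -> H) (le : rel H).

(* The sides of a tile, in the order in which they follow each other. *)
Definition tile_step h h' : bool := covers le h (sg h').

Definition chain_top h : Prop := forall u, le h u -> u = h.
Definition chain_bottom h : Prop := forall u, le u h -> u = h.

End Walks.

Section Converse.

Variables (H : finType) (sg : H -> H) (le : rel H).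
Hypothesis G : chain_gluing sg le.

Let ge : rel H := fun u h => le h u.

Lemma converse_gluing : chain_gluing sg ge.
Proof.
split; rewrite /ge.
- exact: gluing_sgK G.
- exact: gluing_refl G.
- by move=> u h; rewrite andbC => /(gluing_anti G).
- by move=> h u w hu wh; apply: (gluing_trans G wh).
- by move=> u w h hu hw; rewrite orbC; apply: (gluing_up G hu).
- by move=> u w h hu hw; rewrite orbC; apply: (gluing_down G hu).
- by move=> h; rewrite -[X in le _ X](gluing_sgK G); exact: gluing_sg G _.
Qed.

(** Up-sets are chains as well as down-sets, so immediate predecessors and immediate successors are
    inverse to each other. *)
Lemma covers_converse h p : covers ge h p = covers le p h.
Proof.
have imp (r : rel H) : chain_gluing sg r -> covers r h p ->
    covers (fun u h => r h u) p h.
  move=> Gr c; rewrite /covers (covers_le c) eq_sym (covers_neq c) /=.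
  apply/forallP => u; apply/implyP => /andP[pu nup].
  have /orP[//|uh] := gluing_up Gr (covers_le c) pu.
  have [->|nuh] := eqVneq u h; first exact: gluing_refl Gr h.
  have up := covers_max c uh nuh; case/eqP: nup.
  by apply: (gluing_anti Gr); rewrite up pu.
have imp' (r : rel H) : chain_gluing sg r -> covers r p h ->
    covers (fun u h => r h u) h p.
  move=> Gr c; rewrite /covers (covers_le c) eq_sym (covers_neq c) /=.
  apply/forallP => u; apply/implyP => /andP[pu nup].
  have /orP[//|uh] := gluing_up Gr (covers_le c) pu.
  have [->|nuh] := eqVneq u p; first exact: gluing_refl Gr p.
  have up := covers_max c uh nuh; case/eqP: nup.
  by apply: (gluing_anti Gr); rewrite up pu.
by apply/idP/idP; [exact: imp converse_gluing|exact: imp' G].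
Qed.

(** Reversing the order at each marked point mirrors the disc; a walk is then read backwards,
    through the opposite half-edges. *)
Lemma path_tile_step_converse h w : path (tile_step sg ge) h w =
  path (tile_step sg le) (last (sg h) (map sg w))
    (rev (belast (sg h) (map sg w))).
Proof.
rewrite rev_path path_map; apply: eq_path => x y /=.
by rewrite /tile_step covers_converse (gluing_sgK G).
Qed.

End Converse.

(** * Half-edges and tiles of a tiling *)

Section Arcs.

Variable n : nat.
Implicit Types (a b c i x y z : 'I_n) (s t u : 'I_n * 'I_n).

Definition opp_side s : 'I_n * 'I_n := (s.2, s.1).

Lemma opp_sideK : involutive opp_side.
Proof. by case. Qed.

Lemma opp_side_inj : injective opp_side.
Proof. exact: can_inj opp_sideK. Qed.

Lemma eq_ord x y : (x == y) = (x == y :> nat).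
Proof. by []. Qed.

Lemma in_segments i s : (i \in segments s) = (i == s.1) || ccw s.1 i s.2.
Proof. by rewrite inE. Qed.

Lemma segments_opp s : s.1 != s.2 -> segments (opp_side s) = ~: segments s.
Proof.
case: s => a b /= ab; apply/setP => i; rewrite in_setC !in_segments /= /ccw.
move: ab; rewrite !eq_ord; lia.
Qed.

Lemma ccw_rot a b c : ccw a b c = ccw b c a.
Proof. by rewrite /ccw; lia. Qed.

Lemma ccw_total a b c : a != b -> a != c -> b != c -> ccw a b c || ccw a c b.
Proof. by rewrite /ccw !eq_ord; lia. Qed.

(** Inclusion of arcs read off from the cyclic order of the four end points, a form suited to linear
    arithmetic. *)
Definition subarc s t : bool :=
  ((s.1 == t.1) || ccw t.1 s.1 t.2) && ((s.2 == t.2) || ccw s.1 s.2 t.2).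

Lemma ord_predecessor x : exists i : 'I_n, i.+1 = x :> nat \/ (x = 0 :> nat) /\
  i.+1 = n.
Proof.
have xn := ltn_ord x; case: n x xn => [|m] // x xn.
case: x xn => -[|k] km _ /=.
  by exists ord_max; right.
by exists (inord k); left; rewrite inordK // ltnW.
Qed.

Lemma segments_sub s t : s.1 != s.2 -> t.1 != t.2 ->
  (segments s \subset segments t) = subarc s t.
Proof.
case: s => a b; case: t => c d /= ab cd; rewrite /subarc /=.
apply/idP/idP => [/subsetP st|st].
  (* Three segments suffice to test the inclusion: the first one [a] and the last one [i] of the arc
     of [s], and [d], the first one beyond the arc of [t]. *)
  have [i ib] := ord_predecessor b.
  have := st a; have := st i; have := st d; rewrite !in_segments /= /ccw;
    move: ab cd ib.
  have := (ltn_ord a, ltn_ord b, ltn_ord c, ltn_ord d) => -[[[? ?] ?] ?].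
  rewrite !eq_ord; lia.
apply/subsetP => i; rewrite !in_segments /=; move: st ab cd;
  rewrite /ccw !eq_ord.
lia.
Qed.

(* The diagonals at a marked point, ordered counterclockwise. *)
Definition fan_le s t : bool :=
  (s.1 == t.1) && ((s.2 == t.2) || ccw t.1 s.2 t.2).

Lemma fan_le_anti : antisymmetric fan_le.
Proof.
move=> [a b] [c d] /andP[/andP[/= /eqP -> bd] /andP[/= _ db]]; congr (_, _).
by apply: ord_inj; move: bd db; rewrite /ccw !eq_ord; lia.
Qed.

Lemma fan_le_trans : transitive fan_le.
Proof.
move=> [c d] [a b] [e f] /andP[/= /eqP -> bd] /andP[/= /eqP ce df].
rewrite /fan_le /= ce eqxx /=; move: bd df; rewrite ce /ccw !eq_ord; lia.
Qed.

Lemma fan_le_total s t : s.1 != s.2 -> t.1 != t.2 -> s.1 = t.1 -> fan_le s t ||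
  fan_le t s.
Proof.
case: s t => a b [c d] /= ab cd ac; rewrite /fan_le /= ac !eqxx /=.
by move: ab cd; rewrite ac /ccw !eq_ord; lia.
Qed.

(* The distance, counterclockwise, from the boundary segment i to the marked
   point x. *)
Definition position i x : nat := if i < x then x - i else x + n - i.

Lemma position_inj i : injective (position i).
Proof.
move=> x y; have := (ltn_ord x, ltn_ord y, ltn_ord i) => -[[? ?] ?].
rewrite /position => e; apply: ord_inj; move: e.
by case: ifP; case: ifP; lia.
Qed.

Lemma position_le i x : position i x <= n.
Proof.
by have := (ltn_ord x, ltn_ord i) => -[? ?]; rewrite /position; case: ifP; lia.
Qed.

Lemma position_lt i a c : c != a -> i \in segments (c, a) -> position i a <
  position i c.
Proof.
rewrite in_segments /ccw /position /= !eq_ord.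
have := (ltn_ord a, ltn_ord c, ltn_ord i) => -[[? ?] ?].
by case: ifP; case: ifP; lia.
Qed.

(** The points with position at most that of [m] form one side of a cut of the disc from the segment
    [i] to the segment [m]; a diagonal that does not separate these segments does not cross the
    cut. *)
Lemma position_separation i (m : 'I_n) s : s.1 != s.2 -> (i \in segments s) =
  (m \in segments s) ->
  (position i s.1 <= position i m) = (position i s.2 <= position i m).
Proof.
case: s => p q /=; rewrite !in_segments /ccw /position /= !eq_ord.
have := (ltn_ord p, ltn_ord q, ltn_ord i, ltn_ord m) => -[[[? ?] ?] ?].
case: (ltngtP i p) => ip; case: (ltngtP i q) => iq; case: (ltngtP i m) => im;
  case: (ltngtP p q) => pq; case: (ltngtP m p) => mp; case: (ltngtP m q) => mq;
  rewrite /= ?andbT ?andbF ?orbT ?orbF //=; try lia.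
Qed.

End Arcs.

(** * Nested half-discs and adjacency of sides *)

Section Tiles.

Variables (n : nat) (T : {set {set 'I_n}}).
Hypothesis tilingT : is_tiling T.
Implicit Types (a b c i x y z : 'I_n) (s t u v : 'I_n * 'I_n).
Local Notation S := (@segments n).
Local Notation opp := (@opp_side n).

Lemma sides_neq s : s \in sides T -> s.1 != s.2.
Proof.
rewrite inE => sT; move/forallP: tilingT => /(_ [set s.1; s.2]).
by rewrite sT /= cards2 => /andP[]; case: (_ != _).
Qed.

Lemma opp_sides s : (opp s \in sides T) = (s \in sides T).
Proof. by rewrite !inE /= setUC. Qed.

Lemma diagonal_of_opp s : diagonal_of (opp s) = diagonal_of s.
Proof. by rewrite /diagonal_of /= setUC. Qed.

Lemma diagonal_of_eq s t : diagonal_of s = diagonal_of t -> t = s \/ t = opp s.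
Proof.
case: s t => a b [c d]; rewrite /diagonal_of /opp_side /= => st.
have : c \in [set a; b] by rewrite st !inE eqxx.
have : d \in [set a; b] by rewrite st !inE eqxx orbT.
have : a \in [set c; d] by rewrite -st !inE eqxx.
have : b \in [set c; d] by rewrite -st !inE eqxx orbT.
rewrite !inE => /orP[]/eqP hb /orP[]/eqP ha /orP[]/eqP hd /orP[]/eqP hc;
  by [left; congr (_, _); congruence | right; congr (_, _); congruence].
Qed.

Lemma sides_noncrossing s t : s \in sides T -> t \in sides T ->
  ~~ (ccw s.1 t.1 s.2 && ccw s.2 t.2 s.1).
Proof.
rewrite !inE => sT tT; move/forallP: tilingT => /(_ [set s.1; s.2]).
rewrite sT => /andP[_ /forallP /(_ [set t.1; t.2])]; rewrite tT /=.
apply: contra => st; apply/existsP; exists s.1; apply/existsP; exists s.2.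
by apply/existsP; exists t.1; apply/existsP; exists t.2; rewrite !eqxx.
Qed.

(** [ccw] and [subarc] are restated on natural numbers, so that the end points of each diagonal can
    be put in increasing order before the case analysis. *)
Definition cyclic_lt (a b c : nat) := [|| a < b < c, b < c < a | c < a < b].

Definition sub_cyclic (a b c d : nat) :=
  ((a == c) || cyclic_lt c a d) && ((b == d) || cyclic_lt a b d).

Lemma sub_cyclic_nested_lt (a b c d : nat) : a < b -> c < d ->
  ~~ (cyclic_lt a c b && cyclic_lt b d a) ->
  ~~ (cyclic_lt a d b && cyclic_lt b c a) ->
  [|| sub_cyclic a b c d, sub_cyclic a b d c, sub_cyclic b a c d
    | sub_cyclic b a d c].
Proof.
move=> ab cd; rewrite /sub_cyclic /cyclic_lt.
case: (ltngtP a c) => ac; case: (ltngtP a d) => ad; case: (ltngtP b c) => bc;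
  case: (ltngtP b d) => bd;
  by rewrite ?ab ?cd ?(ltn_geF ab) ?(ltn_geF cd) /= ?andbF ?orbT ?andbT //=;
    lia.
Qed.

Lemma sub_cyclic_nested (a b c d : nat) : a != b -> c != d ->
  ~~ (cyclic_lt a c b && cyclic_lt b d a) ->
  ~~ (cyclic_lt a d b && cyclic_lt b c a) ->
  [|| sub_cyclic a b c d, sub_cyclic a b d c, sub_cyclic b a c d
    | sub_cyclic b a d c].
Proof.
rewrite !neq_ltn => /orP[] ab /orP[] cd c1 c2.
- exact: sub_cyclic_nested_lt.
- by have := sub_cyclic_nested_lt ab cd c2 c1; case/or4P => ->; rewrite ?orbT.
- have := sub_cyclic_nested_lt ab cd; rewrite andbC => /(_ c2).
  by rewrite andbC => /(_ c1); case/or4P => ->; rewrite ?orbT.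
- have := sub_cyclic_nested_lt ab cd; rewrite andbC => /(_ c1).
  by rewrite andbC => /(_ c2); case/or4P => ->; rewrite ?orbT.
Qed.

(** Each of two noncrossing chords lies within one half-disc of the other. The arguments on
    adjacency and separation are case analyses on these four inclusions. *)
Lemma sides_nested s t : s \in sides T -> t \in sides T ->
  [|| S s \subset S t, S s \subset S (opp t), S (opp s) \subset S t
    | S (opp s) \subset S (opp t)].
Proof.
move=> sT tT; have s12 := sides_neq sT; have t12 := sides_neq tT.
have c1 := sides_noncrossing sT tT.
have c2 : ~~ (ccw s.1 (opp t).1 s.2 && ccw s.2 (opp t).2 s.1).
  by apply: sides_noncrossing; rewrite ?opp_sides.
rewrite !segments_sub //= 1?eq_sym //.
exact: (sub_cyclic_nested s12 t12 c1 c2).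
Qed.

Lemma segments_inj s t : s \in sides T -> t \in sides T -> S s = S t -> s = t.
Proof.
move=> /sides_neq s12 /sides_neq t12 st.
have : S s \subset S t by rewrite st.
have : S t \subset S s by rewrite st.
rewrite !segments_sub // /subarc; case: s t s12 t12 {st} => a b [c d] /=.
rewrite /ccw => ab cd h1 h2; have [ac bd] : a = c /\ b = d.
  by split; apply: val_inj; move: ab cd h1 h2 => /=; rewrite !eq_ord; lia.
by rewrite ac bd.
Qed.

Lemma segments_neq0 s : S s != set0.
Proof. by apply/set0Pn; exists s.1; rewrite in_segments eqxx. Qed.

Lemma segments_disjoint s t : s \in sides T -> t \in sides T ->
  S s \subset S t -> S (opp s) \subset S t -> False.
Proof.
move=> sT tT st; rewrite segments_opp ?sides_neq // => nst.
have /set0Pn[i] := segments_neq0 (opp t).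
rewrite segments_opp ?sides_neq // in_setC => /negP[].
have [/(subsetP st)//|/negPf is_] := boolP (i \in S s).
by apply: (subsetP nst); rewrite in_setC is_.
Qed.

Lemma segments_oppS s t : s \in sides T -> t \in sides T ->
  (S (opp s) \subset S (opp t)) = (S t \subset S s).
Proof. by move=> sT tT; rewrite !segments_opp ?sides_neq // setCS. Qed.

Lemma segments_oppl s t : s \in sides T -> t \in sides T ->
  (S (opp s) \subset S t) = (S (opp t) \subset S s).
Proof. by move=> sT tT; rewrite -[t in LHS]opp_sideK segments_oppS //
  opp_sides. Qed.

Lemma segments_oppr s t : s \in sides T -> t \in sides T ->
  (S s \subset S (opp t)) = (S t \subset S (opp s)).
Proof. by move=> sT tT; rewrite -[s in LHS]opp_sideK segments_oppS //
  opp_sides. Qed.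

(** The same relation as [adjacent_region], with proper inclusion replaced by inclusion and
    distinctness of sides; this is possible because a side is determined by its segments. *)
Definition adjacent s t : Prop :=
  [/\ S (opp s) \subset S t, opp s != t & forall u, u \in sides T ->
      S (opp s) \subset S u -> S u \subset S t -> u = opp s \/ u = t].

Lemma adjacent_regionP s t : s \in sides T -> t \in sides T ->
  reflect (adjacent s t) (adjacent_region T s t).
Proof.
move=> sT tT; rewrite /adjacent_region -segments_opp ?sides_neq //.
have oT : opp s \in sides T by rewrite opp_sides.
have properE u v : u \in sides T -> v \in sides T ->
    (S u \proper S v) = (S u \subset S v) && (u != v).
  move=> uT vT; rewrite properEneq andbC; congr (_ && _).
  by congr (~~ _); apply/eqP/eqP => [/(segments_inj uT vT)|->].
apply: (iffP andP) => [[]|[st nst nb]]; rewrite properE //.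
  move=> /andP[st nst] /forallP nb; split=> // u uT su ut.
  have := nb u; rewrite uT !properE // su ut /= negb_and !negbK.
  by case/orP => /eqP ->; [left|right].
rewrite st nst; split=> //; apply/forallP => u; apply/implyP => uT.
rewrite !properE //; apply/negP => /andP[/andP[su nsu] /andP[ut nut]].
by have [e|e] := nb u uT su ut; [rewrite e eqxx in nsu|rewrite e eqxx in nut].
Qed.

Lemma adjacent_sym s t : s \in sides T -> t \in sides T ->
  adjacent s t -> adjacent t s.
Proof.
move=> sT tT [st nst nb]; split.
- by rewrite segments_oppl.
- by apply: contra nst => /eqP <-; rewrite opp_sideK.
- move=> u uT tu us; have := nb (opp u).
  rewrite opp_sides uT segments_oppS // us segments_oppl // tu.
  by move=> /(_ isT isT isT)[/opp_side_inj|<-]; [right|left; rewrite opp_sideK].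
Qed.

(** This makes each tile an equivalence class of sides. In every unwanted nesting, either a side
    separates two adjacent ones or a half-disc contains both sides of a diagonal. *)
Lemma adjacent_trans s t u : s \in sides T -> t \in sides T -> u \in sides T ->
  adjacent s t -> adjacent t u -> u != s -> adjacent s u.
Proof.
move=> sT tT uT [st nst nbst] [tu ntu nbtu] nus.
have osT : opp s \in sides T by rewrite opp_sides.
have otT : opp t \in sides T by rewrite opp_sides.
have ouT : opp u \in sides T by rewrite opp_sides.
have ts : S (opp t) \subset S s by rewrite segments_oppl.
have ndis w : w \in sides T -> ~~ (S t \subset S w) || ~~ (S (opp t) \subset S
  w).
  by move=> wT; rewrite -negb_and; apply/negP => /andP[];
    exact: segments_disjoint.
split.
- have /or4P[su|su|//|su] := sides_nested sT uT.
  + have [e|e] := nbtu s sT ts su; last by rewrite e eqxx in nus.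
    by case/eqP: nst; rewrite e opp_sideK.
  + have := ndis _ tT; rewrite subxx (subset_trans tu) //.
    by apply: subset_trans st; rewrite -segments_oppr.
  + have ut : S (opp u) \subset S t by rewrite segments_oppl.
    have [/opp_side_inj e|e] := nbst (opp u) ouT su ut.
      by rewrite e eqxx in nus.
    by case/eqP: ntu; rewrite -e opp_sideK.
- apply/eqP => su; rewrite -su segments_oppS // in tu.
  exact: (segments_disjoint sT tT tu st).
- move=> w wT sw wu; have /or4P[wt|wt|wt|wt] := sides_nested wT tT.
  + have [->|e] := nbst w wT sw wt; first by left.
    by have := ndis _ uT; rewrite -e wu e tu.
  + have := ndis _ sT; rewrite ts -segments_oppS ?(subset_trans sw) //.
  + have tw : S (opp t) \subset S w by rewrite segments_oppl.
    have [e|->] := nbtu w wT tw wu; last by right.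
    by have := ndis _ sT; rewrite ts -segments_oppS // -e sw.
  + have := ndis _ uT; rewrite tu (subset_trans _ wu) //.
    by rewrite -segments_oppS.
Qed.

End Tiles.

(** * Half-edges and steps around a tile *)

Section TileWalks.

Variables (n : nat) (T : {set {set 'I_n}}).
Hypothesis tilingT : is_tiling T.
Implicit Types (a b c i x y z : 'I_n) (s t u v : 'I_n * 'I_n).
Local Notation opp := (@opp_side n).

Lemma mem_tile_at s t :
  (t \in tile_at T s) = (t \in sides T) && ((t == s) || adjacent_region T s t).
Proof. by rewrite inE. Qed.

Lemma tile_at_sides s t : t \in tile_at T s -> t \in sides T.
Proof. by rewrite mem_tile_at => /andP[]. Qed.

Lemma tile_at_refl s : s \in sides T -> s \in tile_at T s.
Proof. by move=> sT; rewrite mem_tile_at sT eqxx. Qed.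

Lemma tile_at_adjacent s t : s \in sides T -> t \in tile_at T s -> t != s ->
  adjacent T s t.
Proof.
move=> sT; rewrite mem_tile_at => /andP[tT /orP[->//|st] _].
exact/(adjacent_regionP tilingT sT tT).
Qed.

Lemma tile_at_sym s t : s \in sides T -> t \in tile_at T s -> s \in tile_at T t.
Proof.
move=> sT ts; have tT := tile_at_sides ts.
have [->|nts] := eqVneq t s; first exact: tile_at_refl.
rewrite mem_tile_at sT /=; apply/orP; right.
apply/(adjacent_regionP tilingT tT sT)/(adjacent_sym tilingT sT tT).
exact: tile_at_adjacent ts nts.
Qed.

Lemma tile_at_trans s t u : s \in sides T -> t \in tile_at T s ->
  u \in tile_at T t -> u \in tile_at T s.
Proof.
move=> sT ts ut; have tT := tile_at_sides ts; have uT := tile_at_sides ut.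
have [->|nus] := eqVneq u s; first exact: tile_at_refl.
have [e|nts] := eqVneq t s; first by rewrite -e.
have [->//|nut] := eqVneq u t.
rewrite mem_tile_at uT /=; apply/orP; right.
apply/(adjacent_regionP tilingT sT uT).
apply: (adjacent_trans tilingT sT tT uT) nus; exact: tile_at_adjacent.
Qed.

Lemma tile_at_eq s t : s \in sides T -> t \in tile_at T s -> tile_at T t =
  tile_at T s.
Proof.
move=> sT ts; have tT := tile_at_sides ts.
apply/setP => u; apply/idP/idP; first exact: tile_at_trans.
by apply: tile_at_trans => //; exact: tile_at_sym.
Qed.

(** A pair [(x, y)] serves both as the half at [x] of a diagonal and as the side running from [x] to
    [y], so fans and tiles are read off the same set. *)
Definition half_edge : finType := {s : 'I_n * 'I_n | s \in sides T}.
Implicit Types g h p w : half_edge.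

Lemma half_edge_neq h : (val h).1 != (val h).2.
Proof. exact: (sides_neq tilingT (valP h)). Qed.

Lemma opp_half_edge_subproof h : opp (val h) \in sides T.
Proof. by rewrite opp_sides (valP h). Qed.

Definition opp_half_edge h : half_edge := Sub (opp (val h))
  (opp_half_edge_subproof h).

Definition half_edge_le : rel half_edge := relpre val (@fan_le n).

Lemma half_edge_gluing : chain_gluing opp_half_edge half_edge_le.
Proof.
split.
- by move=> h; apply: val_inj; rewrite /= opp_sideK.
- by move=> h; rewrite /half_edge_le /= /fan_le !eqxx.
- by move=> u h /fan_le_anti /val_inj.
- by move=> h u w; apply: fan_le_trans.
- move=> u w h /andP[/eqP e1 _] /andP[/eqP e2 _].
  by apply: fan_le_total (half_edge_neq u) (half_edge_neq w) _; rewrite e1 e2.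
- move=> u w h /andP[/eqP e1 _] /andP[/eqP e2 _].
  by apply: fan_le_total (half_edge_neq u) (half_edge_neq w) _; rewrite -e1 -e2.
- move=> h; apply/negP => /andP[/eqP /= e _].
  by have := half_edge_neq h; rewrite e eqxx.
Qed.

Local Notation le := half_edge_le.
Local Notation sg := opp_half_edge.
Local Notation step := (tile_step sg le).

(* In the tile to the left of (x, y), the next side is (z, x), where z is the
   last end point before y of a diagonal at x. *)
Lemma tile_stepP h h' : reflect
  [/\ (val h').2 = (val h).1, ccw (val h).1 (val h').1 (val h).2 &
      forall c, (c, (val h).1) \in sides T -> ccw (val h).1 c (val h).2 ->
        (c == (val h').1) || ccw (val h).1 c (val h').1]
  (step h h').
Proof.
apply: (iffP and3P) => [[]|[e hh' hmax]].
  move=> /andP[/= /eqP e hh'] nhh' /forallP hmax; split=> //.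
    case/orP: hh' => // /eqP e2; case/eqP: nhh'; apply: val_inj => /=.
    by rewrite /opp_side e e2 -surjective_pairing.
  move=> c cT chh; have oc : ((val h).1, c) \in sides T by rewrite -opp_sides.
  have := hmax (Sub ((val h).1, c) oc : half_edge);
    rewrite /half_edge_le /= /fan_le /= !eqxx chh orbT e eqxx /=.
  move/implyP; apply; apply: contraTneq chh => /(congr1 val) /= <-.
  by rewrite /ccw /=; lia.
split.
- by rewrite /half_edge_le /= /fan_le /= e eqxx hh' orbT.
- apply: contraTneq hh' => /(congr1 val) /= <-; rewrite /ccw /=; lia.
apply/forallP => u; apply/implyP => /andP[/andP[/= /eqP e1 uh] nuh].
rewrite /half_edge_le /= /fan_le /= e e1 eqxx /=; apply: hmax.
  by rewrite -opp_sides /opp_side /= -e1 -surjective_pairing (valP u).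
case/orP: uh => // /eqP e2; case/eqP: nuh; apply: val_inj.
by rewrite [val u]surjective_pairing e1 e2 -surjective_pairing.
Qed.

Lemma tile_step_at h h' : step h h' -> val h' \in tile_at T (val h).
Proof.
move/tile_stepP => [e hh' hmax]; have hn := half_edge_neq h.
have h'n := half_edge_neq h'; have hT := valP h; have h'T := valP h'.
rewrite mem_tile_at h'T /=; apply/orP; right.
apply/(adjacent_regionP tilingT hT h'T).
move: (val h) (val h') e hh' hmax hn h'n hT h'T => [a b] [c a'] /= -> {a'}.
move=> cab hmax ab ca hT h'T; split.
- rewrite (segments_sub (s := opp _)) /subarc //= 1?eq_sym //.
  by move: ab cab; rewrite /ccw !eq_ord; lia.
- by apply: contraTneq cab => -[<-]; rewrite /ccw; lia.
- move=> [p q] uT; have /= un := sides_neq tilingT uT.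
  rewrite !segments_sub /subarc //= 1?eq_sym // => h1 h2.
  (* The arc of [(p, q)] lies between the arcs of [(b, a)] and [(c, a)], so it also ends at [a]; the
     choice of [c] then leaves only these two sides. *)
  have e2 : q = a.
    apply: ord_inj; move: h1 h2 un ab cab; rewrite /ccw !eq_ord; lia.
  rewrite e2 in uT un h1 h2 *.
  have [->|np] := eqVneq p b; first by left.
  right; congr (_, _); have := hmax p uT.
  have -> : ccw a p b by move: h1 h2 np un ab cab; rewrite /ccw !eq_ord; lia.
  move=> /(_ isT) h3; apply: ord_inj.
  by move: h1 h2 h3 np un ab cab; rewrite /ccw !eq_ord; lia.
Qed.

End TileWalks.

(** * Walks around open tiles *)

Section OpenTiles.

Variables (n : nat) (T : {set {set 'I_n}}).
Hypothesis tilingT : is_tiling T.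
Implicit Types (a b c i m x y z : 'I_n) (s t u v : 'I_n * 'I_n).
Local Notation S := (@segments n).
Local Notation opp := (@opp_side n).
Local Notation half_edge := (half_edge T).
Implicit Types (g h : half_edge) (w : seq half_edge).
Local Notation le := (@half_edge_le n T).
Local Notation sg := (@opp_half_edge n T).
Local Notation step := (tile_step sg le).

Lemma tile_step_arrow h h' : step h h' ->
  arrow_in (tile_at T (val h)) (diagonal_of (val h)) (diagonal_of (val h')).
Proof.
move=> hh'; have [e ch _] := tile_stepP tilingT h h' hh'.
apply/existsP; exists (val h).1; apply/existsP; exists (val h).2.
apply/existsP; exists (val h').1; rewrite eqxx ch /=; apply/and3P; split.
- by rewrite /diagonal_of e setUC.
- by apply/existsP; exists (val h); rewrite tile_at_refl ?eqxx ?(valP h).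
- by apply/existsP; exists (val h'); rewrite tile_step_at ?eqxx.
Qed.

Lemma arrow_tile_step s d1 d2 : s \in sides T -> arrow_in (tile_at T s) d1 d2 ->
  exists h h', [/\ step h h', val h \in tile_at T s, val h' \in tile_at T s,
    d1 = diagonal_of (val h) & d2 = diagonal_of (val h')].
Proof.
move=> sT /existsP[x /existsP[y /existsP[z /and5P[/eqP-> /eqP-> xzy]]]].
move=> /existsP[s1 /andP[s1t /eqP d1E]] /existsP[s2 /andP[s2t /eqP d2E]].
have s1T := tile_at_sides s1t; have s2T := tile_at_sides s2t.
have s21 : s2 \in tile_at T s1.
  by apply: (tile_at_trans tilingT) s2t => //; exact: tile_at_sym.
have n1 := sides_neq tilingT s1T; have n2 := sides_neq tilingT s2T.
have e1 := @diagonal_of_eq _ (x, y) s1 d1E.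
have e2 := @diagonal_of_eq _ (x, z) s2 d2E.
have ns : s2 != s1.
  case: e1 e2 => -> [] ->; rewrite /opp_side xpair_eqE /= negb_and;
    move: xzy; clear; rewrite /ccw !eq_ord; lia.
have [sub _ bet] := tile_at_adjacent tilingT s1T s21 ns.
have n1' : (opp s1).1 != (opp s1).2 by rewrite eq_sym.
(* Of the four choices of sides of the two diagonals, only this one has facing half-discs when [z]
   comes before [y]. *)
have {}e12 : s1 = (x, y) /\ s2 = (z, x).
  move: sub; rewrite segments_sub // /subarc.
  case: e1 e2 n1 n2 => -> [] -> /=; move: xzy; clear; rewrite /ccw !eq_ord;
    first [by [] | by move=> *; exfalso; lia].
move: e12 => [s1E s2E]; rewrite s1E in s1T s1t bet n1 n1';
  rewrite s2E in s2T s2t bet n2.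
exists (Sub (x, y) s1T : half_edge), (Sub (z, x) s2T : half_edge); split=> //=;
  last by rewrite setUC.
apply/tile_stepP => //=; split=> // c cT xcy.
have nc := sides_neq tilingT cT.
(* A diagonal at [x] inside the angle and beyond [z] would separate the two adjacent sides. *)
have := bet (c, x) cT; rewrite !segments_sub // /subarc /= => b.
have [//|ncz] := boolP ((c == z) || ccw x c z).
exfalso; have [] := b _ _.
- by rewrite eqxx andbT -ccw_rot xcy orbT.
- rewrite eqxx andbT; move: ncz; rewrite negb_or => /andP[ncz nxcz].
  have := ccw_total (a := x) (b := z) (c := c); rewrite (negPf nxcz) orbF.
  rewrite ![x == _]eq_sym n2 nc [z == c]eq_sym ncz => /(_ isT isT isT).
  by rewrite ccw_rot => ->; rewrite orbT.
- by move=> [e]; move: xcy; rewrite e /ccw; clear; lia.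
- by move=> [e]; rewrite e eqxx in ncz.
Qed.

(** The arc of a side [(c, a)] of the tile contains [i], so from [i] one meets [a] before [c]. Hence
    the walk advances counterclockwise and never repeats a side. *)
Lemma open_walk i h w : path step h w ->
    (forall u, u \in tile_at T (val h) -> i \in S u) ->
  path (fun g g' => position i (val g).1 < position i (val g').1) h w /\
  all (fun g => val g \in tile_at T (val h)) (h :: w).
Proof.
elim: w h => [|g w IHw] h /=; first by rewrite tile_at_refl ?(valP h).
move=> /andP[hg gw] hi; have ght := tile_step_at tilingT hg.
have tE := tile_at_eq tilingT (valP h) ght.
have [|pw] := IHw g gw; first by rewrite tE.
rewrite tE /= => /andP[gt wt].
rewrite pw ght wt tile_at_refl ?(valP h) // !andbT; split=> //.
have [e _ _] := tile_stepP tilingT h g hg.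
apply: position_lt; rewrite -?e; first exact: half_edge_neq.
by rewrite -surjective_pairing hi.
Qed.

Lemma open_walk_uniq i h w : path step h w ->
  (forall u, u \in tile_at T (val h) -> i \in S u) -> uniq (h :: w).
Proof.
move=> hw /(open_walk hw)[pw _]; apply: (@sorted_uniq _ _ _ _ (h :: w)) pw.
  by move=> g g' g''; exact: ltn_trans.
by move=> g; rewrite ltnn.
Qed.

Lemma open_walk_bound i h w : path step h w ->
    (forall u, u \in tile_at T (val h) -> i \in S u) ->
  size w < max_open_length T.
Proof.
move=> hw hi; have [_ /allP wt] := open_walk hw hi.
apply: (@leq_trans (tile_length (tile_at T (val h)))); last first.
  rewrite /max_open_length; apply: (leq_bigmax_cond (F := @tile_length n)).
  rewrite imset_f ?(valP h) //=; apply/existsP; exists i; apply/forallP => u.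
  by apply/implyP; exact: hi.
pose D := [seq diagonal_of (val g) | g <- h :: w].
have uD : uniq D.
  (* Opposite sides cannot both bound the tile, as [i] lies in only one of two complementary
     half-discs. *)
  rewrite map_inj_in_uniq ?(open_walk_uniq hw hi) // => g g' /wt gt /wt g't.
  case/diagonal_of_eq => [/val_inj//|e]; have := hi _ g't; rewrite e.
  by rewrite segments_opp ?(half_edge_neq tilingT) // in_setC hi.
have -> : (size w).+1 = size D by rewrite size_map.
rewrite -(card_uniqP uD) /tile_length; apply: subset_leq_card.
apply/subsetP => d /mapP[g /wt gt ->]; rewrite inE; apply/existsP.
by exists (val g); rewrite gt eqxx.
Qed.

(** The segment ending at the second end point of [h] will do: a side of the tile that misses it
    would start at this point and come after [sg h] in the fan. *)
Lemma chain_top_open h : chain_top le (sg h) ->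
  exists i, forall u, u \in tile_at T (val h) -> i \in S u.
Proof.
move=> htop; have [i ix] := ord_predecessor (val h).2.
have hn := half_edge_neq tilingT h.
have hn' : (opp (val h)).1 != (opp (val h)).2 by rewrite eq_sym.
exists i => u ut; have uT := tile_at_sides ut; have un := sides_neq tilingT uT.
have [uh|nuh] := eqVneq u (val h).
  rewrite uh in_segments; move: hn ix; case: (val h : 'I_n * 'I_n) => y x /=.
  have := (ltn_ord x, ltn_ord y, ltn_ord i) => -[[? ?] ?].
  rewrite /ccw !eq_ord; lia.
have [sub nou _] := tile_at_adjacent tilingT (valP h) ut nuh.
apply: contraNT nou => iu; rewrite eq_sym; apply/eqP.
have hu : fan_le (opp (val h)) u.
  rewrite segments_sub // /subarc in sub; rewrite /fan_le;
    move: hn un sub iu ix;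
  rewrite in_segments; move: (val h : 'I_n * 'I_n) {hn'} => [y x];
    case: {uT ut nuh} u => p q /=.
  have := (ltn_ord x, ltn_ord y, ltn_ord i, ltn_ord p, ltn_ord q) => -[[[[? ?]
    ?] ?] ?].
  by rewrite /ccw !eq_ord; lia.
exact: (congr1 val (htop (Sub u uT) hu)).
Qed.

(** A side of the tile missing the segment that starts at the first end point of [h] would be
    opposite to a half-edge below [h]. *)
Lemma chain_bottom_open h : chain_bottom le h ->
  forall u, u \in tile_at T (val h) -> (val h).1 \in S u.
Proof.
move=> hbot u ut; have uT := tile_at_sides ut; have un := sides_neq tilingT uT.
have hn := half_edge_neq tilingT h.
have hn' : (opp (val h)).1 != (opp (val h)).2 by rewrite eq_sym.
have [->|nuh] := eqVneq u (val h); first by rewrite in_segments eqxx.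
have [sub nou _] := tile_at_adjacent tilingT (valP h) ut nuh.
apply: contraNT nou => iu.
have ouT : opp u \in sides T by rewrite opp_sides.
have ou : fan_le (opp u) (val h).
  rewrite segments_sub // /subarc in sub; rewrite /fan_le; move: hn un sub iu;
  rewrite in_segments; move: (val h : 'I_n * 'I_n) {hn'} => [y x];
    case: {uT ut nuh ouT} u => p q /=.
  by rewrite /ccw !eq_ord; lia.
by rewrite -(congr1 val (hbot (Sub (opp u) ouT) ou)) opp_sideK.
Qed.

Lemma boundary_walk_bound h w : path step h w ->
  chain_top le (sg h) \/ chain_bottom le (last h w) -> size w < max_open_length
    T.
Proof.
move=> hw [/chain_top_open[i hi]|/chain_bottom_open hi];
  first exact: (open_walk_bound hw hi).
apply: (open_walk_bound hw (i := (val (last h w)).1)) => u uh; apply: hi.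
suff -> : tile_at T (val (last h w)) = tile_at T (val h) by [].
elim: w h hw {uh} => //= g w IHw h /andP[hg gw]; rewrite IHw //.
by apply: tile_at_eq => //; [exact: valP|exact: tile_step_at].
Qed.

End OpenTiles.

(** * Connectedness: one walk through all sides of an open tile *)

Section ConnectedTiles.

Variables (n : nat) (T : {set {set 'I_n}}).
Hypothesis tilingT : is_tiling T.
Implicit Types (a b c i m x y z : 'I_n) (s t u v : 'I_n * 'I_n).
Local Notation S := (@segments n).
Local Notation opp := (@opp_side n).
Local Notation half_edge := (half_edge T).
Implicit Types (g h e : half_edge) (w : seq half_edge).
Local Notation le := (@half_edge_le n T).
Local Notation sg := (@opp_half_edge n T).
Local Notation step := (tile_step sg le).
Let G := half_edge_gluing tilingT.

(** A smallest half-disc between [opp s] and [v], other than [opp s], is separated from [s] by no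
    diagonal. *)
Lemma tile_side_inside s v : s \in sides T -> v \in sides T ->
  S (opp s) \subset S v -> v != opp s ->
  exists2 u, u \in tile_at T s & S u \subset S v.
Proof.
move=> sT vT sv nvs.
pose P u := [&& u \in sides T, S (opp s) \subset S u, u != opp s & S u \subset
  S v].
have Pv : P v by rewrite /P vT sv nvs subxx.
case: (@arg_minnP _ v P (fun u => #|S u|) Pv) => u /and4P[uT su nus uv] umin.
exists u => //; rewrite mem_tile_at uT; apply/orP; right.
apply/(adjacent_regionP tilingT sT uT); split;
  rewrite 1?eq_sym // => z zT sz zu.
have [->|nzs] := eqVneq z (opp s); [by left|right].
apply: (segments_inj tilingT zT uT); apply/eqP; rewrite eqEcard zu umin //.
by rewrite /P zT sz nzs (subset_trans zu).
Qed.

(** Up to replacing [v] by its opposite, its half-disc contains one of the two sides of the diagonal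
    of [s]. If it also contains [i] or [m], it contains a half-disc bounding the tile, hence both
    segments. *)
Lemma tile_not_separated s i m v : s \in sides T -> v \in sides T ->
  (forall u, u \in tile_at T s -> i \in S u) ->
  (forall u, u \in tile_at T s -> m \in S u) ->
  (i \in S v) = (m \in S v).
Proof.
move=> sT vT hi hm; have si := hi _ (tile_at_refl sT).
have sm := hm _ (tile_at_refl sT).
have sub k j (z : 'I_n * 'I_n) : (forall u, u \in tile_at T s -> k \in S u) ->
    (forall u, u \in tile_at T s -> j \in S u) -> z \in sides T ->
    S (opp s) \subset S z \/ S s \subset S z -> k \in S z -> j \in S z.
  move=> hk hj zT [sz|/subsetP sz] kz;
    last exact: (sz _ (hj _ (tile_at_refl sT))).
  have nz : z != opp s.
    apply: contraTneq kz => ->; rewrite segments_opp ?(sides_neq tilingT) //.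
    by rewrite in_setC hk ?tile_at_refl.
  by have [u ut /subsetP uz] := tile_side_inside sT zT sz nz; apply/uz/hj.
have neg k : (k \in S (opp v)) = (k \notin S v).
  by rewrite segments_opp ?(sides_neq tilingT) // in_setC.
have ovT : opp v \in sides T by rewrite opp_sides.
have [sv|sv] : (S (opp s) \subset S v \/ S s \subset S v) \/
               (S (opp s) \subset S (opp v) \/ S s \subset S (opp v)).
  by have /or4P[] := sides_nested tilingT sT vT; tauto.
- by apply/idP/idP; apply: sub.
- by apply: negb_inj; rewrite -!neg; apply/idP/idP; apply: sub.
Qed.

Lemma step_inj g g' h : step g h -> step g' h -> g = g'.
Proof.
have Gc := converse_gluing G; have cc := covers_converse G.
by rewrite /tile_step -!(cc (sg h)); apply: (covers_fun Gc).
Qed.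

Lemma step_exists g : ~ chain_bottom le g -> exists h, step g h.
Proof.
move=> nb; case gp: (chain_pred le g) => [p|].
  by exists (sg p); rewrite /tile_step (gluing_sgK G); apply/(chain_predP G).
by case: nb => u; exact: (chain_pred_None G gp).
Qed.

Lemma step_back_exists h : ~ chain_top le (sg h) -> exists g, step g h.
Proof.
have Gc := converse_gluing G; have cc := covers_converse G.
move=> nt; case gp: (chain_pred (fun g g' => le g' g) (sg h)) => [q|].
  by exists q; rewrite /tile_step -cc; apply/(chain_predP Gc).
by case: nt => u; exact: (chain_pred_None Gc gp).
Qed.

Variables (s : 'I_n * 'I_n) (i : 'I_n).
Hypothesis sT : s \in sides T.
Hypothesis si : forall u, u \in tile_at T s -> i \in S u.

Lemma step_position g h : val g \in tile_at T s -> step g h ->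
  position i (val g).1 < position i (val h).1 /\ val h \in tile_at T s.
Proof.
move=> gt gh; have tE := tile_at_eq tilingT sT gt.
have ht : val h \in tile_at T s by rewrite -tE; apply: tile_step_at.
split=> //; have [e _ _] := tile_stepP tilingT g h gh.
by apply: position_lt; rewrite -e ?(half_edge_neq tilingT) //
  -surjective_pairing si.
Qed.

Lemma step_position_back g h : val h \in tile_at T s -> step g h ->
  position i (val g).1 < position i (val h).1 /\ val g \in tile_at T s.
Proof.
move=> ht gh; have gt : val g \in tile_at T s.
  rewrite -(tile_at_eq tilingT sT ht); apply: tile_at_sym => //;
    first exact: valP.
  exact: tile_step_at.
by have [] := step_position gt gh.
Qed.

(** Each step increases [position], which is at most [n], and a walk can be continued from any
    half-edge that is not a bottom. *)
Lemma walk_to_bottom g : val g \in tile_at T s ->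
  exists w, [/\ path step g w, chain_bottom le (last g w) &
                val (last g w) \in tile_at T s].
Proof.
move: {2}(n - _) (leqnn (n - position i (val g).1)) => d.
elim: d g => [|d IHd] g gd gt;
  have [gb|/step_exists[h gh]] := pselect (chain_bottom le g);
  try (by exists [::]); have [gh_lt ht] := step_position gt gh.
  by have := position_le i (val h).1; move: gd gh_lt; lia.
have [|w [hw hb hwt]] := IHd h _ ht; last by exists (h :: w); rewrite /= gh hw.
by have := position_le i (val h).1; move: gd gh_lt; lia.
Qed.

Lemma walk_from_top g : val g \in tile_at T s ->
  exists h w, [/\ path step h w, chain_top le (sg h), last h w = g &
                val h \in tile_at T s].
Proof.
move: {2}(position _ _) (leqnn (position i (val g).1)) => d.
elim: d g => [|d IHd] g gd gt;
  have [gb|/step_back_exists[h hg]] := pselect (chain_top le (sg g));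
  try (by exists g, [::]); have [lt ht] := step_position_back gt hg.
  by move: gd lt; lia.
have [|h' [w [hw ht' hE h't]]] := IHd h _ ht; first by move: gd lt; lia.
by exists h', (rcons w g); rewrite rcons_path hw hE hg last_rcons.
Qed.

(** Steps are determined backwards, so two walks with the same end agree back to the start of the
    shorter one. No step leads to [h], so the walk from [h] is not strictly shorter. *)
Lemma walk_suffix h w (u : half_edge) (v : seq half_edge) : chain_top le (sg h)
  -> path step h w ->
  path step u v -> last u v = last h w -> u \in h :: w.
Proof.
move=> htop; have nostep g : step g h -> False.
  move=> gh; have gt := htop _ (covers_le gh).
  by have := covers_neq gh; rewrite gt eqxx.
elim/last_ind: w v => [|w e IHw] v.
  case/lastP: v => [_ _ /= ->|v z _]; first by rewrite inE.
  by rewrite rcons_path last_rcons => /andP[_ vz] /= zh; rewrite zh in vz;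
    case: (nostep _ vz).
rewrite rcons_path last_rcons => /andP[hw we].
case/lastP: v => [_ /= ->|v z]; first by rewrite inE mem_rcons inE eqxx orbT.
rewrite rcons_path last_rcons => /andP[uv vz] ze; rewrite ze in vz.
rewrite -rcons_cons mem_rcons inE (IHw v) ?orbT //.
exact: step_inj vz we.
Qed.

(** The geometric form of connectedness; [connected_gluing] provides it from the absence of
    nontrivial central idempotents. *)
Hypothesis connected : forall A : pred 'I_n,
  (forall g, A (val g).1 = A (val g).2) ->
  (forall g, A (val g).1) \/ (forall g, ~~ A (val g).1).

(** A bottom half-edge marks a boundary segment of the tile. No diagonal crosses the cut from [i] to
    this segment, so by connectedness every half-edge starts on the side of the cut where the bottom
    one does. Two bottoms therefore bound each other's positions. *)
Lemma bottom_unique g h : val g \in tile_at T s -> val h \in tile_at T s ->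
  chain_bottom le g -> chain_bottom le h -> g = h.
Proof.
move=> gt ht gb hb.
have le_pos g' h' : val h' \in tile_at T s -> chain_bottom le h' ->
    position i (val g').1 <= position i (val h').1.
  move=> h't h'b; have [|//|no] := @connected (fun x => position i x <=
    position i (val h').1).
    move=> e; apply: position_separation; first exact: half_edge_neq.
    apply: (tile_not_separated sT) => // [|u]; first exact: valP.
    rewrite -(tile_at_eq tilingT sT h't); exact: chain_bottom_open.
  by have := no h'; rewrite leqnn.
have e : (val g).1 = (val h).1.
  by apply: (@position_inj _ i); apply/eqP; rewrite eqn_leq !le_pos.
have /orP[gh|hg] := fan_le_total (half_edge_neq tilingT g) (half_edge_neq
  tilingT h) e.
  exact: hb.
by symmetry; exact: gb.
Qed.

(** From every side of the tile one walks to the same bottom, so by [walk_suffix] all sides lie on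
    the walk traced back from that bottom as far as possible. *)
Lemma tile_is_walk : exists h w,
  [/\ path step h w, chain_top le (sg h), chain_bottom le (last h w),
      val h \in tile_at T s & tile_length (tile_at T s) <= (size w).+1].
Proof.
pose s0 : half_edge := Sub s sT;
  have s0t : val s0 \in tile_at T s by exact: tile_at_refl.
have [w0 [_ eb et]] := walk_to_bottom s0t; set e := last s0 w0 in eb et.
have [h [w [hw htop he ht]]] := walk_from_top et.
exists h, w; split=> //; first by rewrite he.
pose D := [seq diagonal_of (val g) | g <- h :: w].
have -> : (size w).+1 = size D by rewrite size_map.
rewrite /tile_length (leq_trans _ (card_size D)) //; apply: subset_leq_card.
apply/subsetP => d; rewrite inE => /existsP[u /andP[ut /eqP ->]].
apply/mapP; exists (Sub u (tile_at_sides ut)) => //.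
have [v [uv vb vt]] := @walk_to_bottom (Sub u (tile_at_sides ut)) ut.
by apply: (walk_suffix htop hw uv); rewrite he; apply: bottom_unique.
Qed.

End ConnectedTiles.

Lemma maximal_walk n (T : {set {set 'I_n}}) : is_tiling T ->
  1 < max_open_length T ->
  (forall A : pred 'I_n,
    (forall g : half_edge T, A (val g).1 = A (val g).2) ->
    (forall g : half_edge T, A (val g).1) \/ (forall g : half_edge T, ~~ A (val
      g).1)) ->
  exists h w, [/\ path (tile_step (@opp_half_edge n T) (@half_edge_le n T)) h w,
    chain_top (@half_edge_le n T) (opp_half_edge h),
    chain_bottom (@half_edge_le n T) (last h w) & (size w).+1 = max_open_length
      T].
Proof.
move=> tilingT k1 connected.
have [t /andP[tT /existsP[i /forallP ti]] tk] : exists2 t, (t \in tiles T) &&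
  open_tile t &
    max_open_length T = tile_length t.
  have [t0 t0P|none] := pickP (fun t => (t \in tiles T) && open_tile t).
    have card0 : 0 < #|[pred t | (t \in tiles T) && open_tile t]| by
      apply/card_gt0P; exists t0.
    have [t tP tE] := eq_bigmax_cond (@tile_length n) card0.
    by exists t; [exact: tP|rewrite -tE].
  (* Without an open tile the maximum would be 0. *)
  by move: k1; rewrite /max_open_length big_pred0.
case/imsetP: tT ti tk => s sT -> ti tk.
have si u : u \in tile_at T s -> i \in segments u by move=> ut; have := ti u;
  rewrite ut.
have [h [w [hw htop hbot ht hsize]]] := tile_is_walk tilingT sT si connected.
exists h, w; split=> //; apply/eqP; rewrite eqn_leq {2}tk hsize andbT.
by apply: (boundary_walk_bound tilingT hw); left.
Qed.

Import GRing.Theory.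
Local Open Scope ring_scope.

(** * Injective modules and resolutions *)

Section LinearMaps.

Variables (R : pzRingType) (M N : lmodType R).

Definition linear_map (f : M -> N) (fL : linear f) : {linear M -> N} :=
  HB.pack f (GRing.isLinear.Build R M N _ f fL).

Lemma linear_mapE (f : M -> N) (fL : linear f) x : linear_map fL x = f x.
Proof. by []. Qed.

End LinearMaps.

Section Submodules.

Variables (R : pzRingType) (N : lmodType R) (S : N -> Prop).
Hypothesis S0 : S 0.
Hypothesis SL : forall a x y, S x -> S y -> S (a *: x + y).

Definition in_submodule (x : N) : bool := `[< S x >].

Lemma in_submodule_closed : submod_closed in_submodule.
Proof.
split; first exact/asboolP.
by move=> a x y /asboolP Sx /asboolP Sy; apply/asboolP/SL.
Qed.

Record submodule := Submodule { submodule_val :> N;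
  _ : in_submodule submodule_val }.
HB.instance Definition _ := [isSub for submodule_val].
HB.instance Definition _ := [Choice of submodule by <:].
HB.instance Definition _ :=
  GRing.SubChoice_isSubLmodule.Build R N in_submodule submodule
    in_submodule_closed.

(** Here [f] is a function on all of [N] that is linear on [S] only, so that partial maps can be
    used without a subtype. *)
Lemma injective_extension_of (E : lmodType R) (f : N -> E) :
  injective_module E ->
  (forall a x y, S x -> S y -> f (a *: x + y) = a *: f x + f y) ->
  exists g : {linear N -> E}, forall x, S x -> g x = f x.
Proof.
move=> injE fL.
have fsL : linear (fun x : submodule => f (val x)).
  by move=> a [x Sx] [y Sy]; apply: fL; apply/asboolP.
have vL : linear (val : submodule -> N) by move=> a x y; rewrite linearP.
have [g gP] := injE _ _ (linear_map vL) (linear_map fsL) val_inj.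
exists g => x Sx.
have Px : in_submodule x by apply/asboolP.
exact: (gP (Submodule Px)).
Qed.

End Submodules.

(** * Extension of linear functionals on vector spaces *)

Section FunctionalExtension.

Variables (K : fieldType) (V : lmodType K) (S : V -> Prop) (f : V -> K).
Hypothesis S0 : S 0.
Hypothesis SL : forall a x y, S x -> S y -> S (a *: x + y).
Hypothesis fL : forall a x y, S x -> S y -> f (a *: x + y) = a * f x + f y.

Lemma functional_extension :
  exists F : V -> K, (forall a x y, F (a *: x + y) = a * F x + F y) /\
                     forall x, S x -> F x = f x.
Proof.
pose lin (G : (V * K -> Prop)) := forall a p q, G p -> G q ->
  G (a *: p.1 + q.1, a * p.2 + q.2).
pose G0 : (V * K -> Prop) := fun p => S p.1 /\ p.2 = f p.1.
(* Zorn's lemma is applied to graphs of partial functionals. Only nonempty ones must contain [G0],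
   because the union of the empty chain has to satisfy [P]. *)
pose P (G : (V * K -> Prop)) := [/\ lin G, forall c, G (0, c) -> c = 0
  & (exists p, G p) -> forall p, G0 p -> G p].
have PG0 : P G0.
  split=> // [a [x c] [y d] [/= Sx cE] [/= Sy dE]|c [_ /= ->]].
    by rewrite cE dE; split=> /=; [exact: SL|rewrite fL].
  by have := fL 1 S0 S0; rewrite scaler0 addr0 mul1r -[X in X = _]addr0 =>
    /addrI.
have [|A [[Alin Afun Aext] Amax]] := @classical_sets.Zorn_bigcup _ P.
  move=> F FP Ftot; split.
  - move=> a p q [G FG Gp] [G' FG' G'q].
    have [GG'|G'G] := Ftot _ _ FG FG'.
      by exists G' => //; have [l _ _] := FP _ FG'; apply: l => //; exact: GG'.
    by exists G => //; have [l _ _] := FP _ FG; apply: l => //; exact: G'G.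
  - by move=> c [G FG Gc]; have [_ z _] := FP _ FG; exact: z.
  - move=> [p [G FG Gp]] q G0q; exists G => //.
    by have [_ _ e] := FP _ FG; apply: e => //; exists p.
have Ane : exists p, A p.
  apply: contrapT => A0; apply: (Amax G0) => //; split.
    by move=> p Ap; case: A0; exists p.
  by move=> G0A; case: A0; exists (0, f 0); apply: G0A.
have A00 : A (0, 0).
  have [p Ap] := Ane; have := Alin (-1) p p Ap Ap.
  by rewrite scaleN1r mulN1r !addNr.
have Atot x : exists c, A (x, c).
  apply: contrapT => nAx.
  (* The extension of [A] with the value 0 at [x]. *)
  pose B : (V * K -> Prop) := fun p => exists y a, A (y, p.2) /\ p.1 = y + a *:
    x.
  apply: (Amax B); first split.
  - by move=> [y c] Ay; exists y, 0; rewrite scale0r addr0.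
  - move=> BA; case: nAx; exists 0; apply: BA; exists 0, 1.
    by rewrite scale1r add0r.
  split.
  - move=> a [y c] [z d] [y' [b [/= Ay ->]]] [z' [b' [/= Az ->]]].
    exists (a *: y' + z'), (a * b + b'); split; first exact: (Alin a _ _ Ay Az).
    by rewrite /= scalerDr scalerDl scalerA addrACA.
  - move=> c [y [a [/= Ay /esym/eqP]]].
    have [->|a0] := eqVneq a 0.
      by rewrite scale0r addr0 => /eqP y0; apply: Afun; rewrite -y0.
    rewrite addr_eq0 => /eqP yE; case: nAx; exists (- a^-1 * c).
    have := Alin (- a^-1) _ _ Ay A00.
    by rewrite /= !addr0 yE scalerN scaleNr opprK scalerA mulVf // scale1r.
  - by move=> _ p G0p; exists p.1, 0; rewrite scale0r addr0; split=> //;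
      case: p G0p => ? ? ?; exact: Aext.
have [F AF] := choice Atot.
have Auniq x c d : A (x, c) -> A (x, d) -> c = d.
  move=> Ac Ad; apply/eqP; rewrite -subr_eq0; apply/eqP/Afun.
  by have := Alin (-1) _ _ Ad Ac; rewrite /= scaleN1r mulN1r addNr addrC.
exists F; split=> [a x y|x Sx].
  by apply: (Auniq (a *: x + y)) => //; exact: (Alin a _ _ (AF x) (AF y)).
by apply: (Auniq x) => //; apply: Aext.
Qed.

End FunctionalExtension.

(** A copy of [N] on which [K] is to act through [iota], so that vector space arguments apply to
    [R]-modules. *)
Definition restrict_scalars (K : fieldType) (R : pzRingType)
  (iota : {rmorphism K -> R}) (N : lmodType R) : Type := N.

Section RestrictScalars.

Variables (K : fieldType) (R : pzRingType) (iota : {rmorphism K -> R}).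
Variable N : lmodType R.
Local Notation NK := (restrict_scalars iota N).

HB.instance Definition _ := GRing.Zmodule.on NK.

Definition restrict_scale (c : K) (x : NK) : NK := iota c *: (x : N).

Lemma restrict_scaleA a b v :
  restrict_scale a (restrict_scale b v) = restrict_scale (a * b) v.
Proof. by rewrite /restrict_scale scalerA rmorphM. Qed.

Lemma restrict_scale1 : left_id 1 restrict_scale.
Proof. by move=> v; rewrite /restrict_scale rmorph1 scale1r. Qed.

Lemma restrict_scaleDr : right_distributive restrict_scale +%R.
Proof. by move=> a u v; rewrite /restrict_scale scalerDr. Qed.

Lemma restrict_scaleDl v : {morph restrict_scale^~ v : a b / a + b}.
Proof. by move=> a b; rewrite /restrict_scale rmorphD scalerDl. Qed.

HB.instance Definition _ := GRing.Zmodule_isLmodule.Build K NK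
  restrict_scaleA restrict_scale1 restrict_scaleDr restrict_scaleDl.

End RestrictScalars.

Lemma functional_extension_along (K : fieldType) (R : pzRingType)
    (iota : {rmorphism K -> R}) (M N : lmodType R) (i : {linear M -> N})
    (f : M -> K) :
  injective i -> (forall c x y, f (iota c *: x + y) = c * f x + f y) ->
  exists F : N -> K, (forall c x y, F (iota c *: x + y) = c * F x + F y) /\
                     forall x, F (i x) = f x.
Proof.
move=> inji fL.
have [//|h hP] := @choice N M (fun y x => (exists z, i z = y) -> i x = y).
  move=> y; have [[z <-]|nz] := pselect (exists z, i z = y); first by exists z.
  by exists 0.
have hK x : h (i x) = x by apply: inji; apply: hP; exists x.
pose S (y : N) := exists x, i x = y.
have [||a x y|F [FL Ff]] := @functional_extension K (restrict_scalars iota N) S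
    (fun y => f (h y)).
- by exists 0; rewrite raddf0.
- by move=> a _ _ [x <-] [y <-]; exists (iota a *: x + y); rewrite linearP.
- move=> [{}x <-] [{}y <-].
  have -> : a *: (i x : restrict_scalars iota N) + i y = i (iota a *: x + y).
    by rewrite linearP.
  by rewrite !hK fL.
by exists F; split=> [|x]; [exact: FL|rewrite Ff ?hK//; exists x].
Qed.

Section InjectiveDimensionBound.

Variable R : pzRingType.

(** A recursion on cokernels suits a construction by short exact sequences; [injective_resolutionP]
    splices them into one complex. *)
Fixpoint injdim_le (m : nat) (M : lmodType R) : Prop :=
  if m is m'.+1 then
    exists (E C : lmodType R) (i : {linear M -> E}) (p : {linear E -> C}),
      [/\ injective_module E, injective i,
          forall x, p x = 0 <-> exists y, i y = x,
          forall z, exists x, p x = z & injdim_le m' C]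
  else injective_module M.

Lemma zero_module_injective (Z : lmodType R) :
  (forall x : Z, x = 0) -> injective_module Z.
Proof.
move=> Z0 M N i f _; have zL : linear (fun _ : N => (0 : Z)).
  by move=> a x y; rewrite scaler0 addr0.
by exists (linear_map zL) => x; rewrite linear_mapE [RHS]Z0.
Qed.

Lemma injective_resolutionP m M : injdim_le m M -> has_injective_resolution M m.
Proof.
elim: m M => [|m IHm] M.
  move=> injM; pose Z : lmodType R := 'rV[R]_0.
  have Z0 (x : Z) : x = 0 by apply/rowP; case.
  pose E i : lmodType R := if i is _.+1 then Z else M.
  have dL i : linear (fun _ : E i => (0 : E i.+1)).
    by move=> a x y; rewrite scaler0 addr0.
  have idL : linear (fun x : M => (x : E 0)) by [].
  exists E, (linear_map idL), (fun i => linear_map (dL i)); split.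
  - by split=> // x; split=> // _; exists x.
  - move=> i x; split=> [_|_]; last exact: linear_mapE.
    exists 0; rewrite linear_mapE; symmetry; exact: Z0.
  - by case=> // i; apply: zero_module_injective.
  - by case.
move=> [E [C [i [p [injE inji ip pC /IHm]]]]].
move=> [E' [eta [delta [[injeta exeta] exdelta injE' E'0]]]].
pose EE i : lmodType R := if i is j.+1 then E' j else E.
have epL : linear (fun x : E => eta (p x)) by move=> a x y; rewrite !linearP.
pose dd j : {linear EE j -> EE j.+1} :=
  match j return {linear EE j -> EE j.+1} with
  | 0 => linear_map epL
  | j'.+1 => delta j'
  end.
exists EE, i, dd; split.
- split=> // x; rewrite linear_mapE -ip; split=> [|->]; last by rewrite raddf0.
  by move=> e0; apply: injeta; rewrite e0 raddf0.
- case=> [|j] x; last exact: exdelta.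
  rewrite exeta; split=> [[y <-]|[y <-]]; last by exists (p y).
  by have [z <-] := pC y; exists z.
- by case.
- by case=> // j; exact: E'0.
Qed.

Lemma injdim_le_prod m (F M : lmodType R) :
  injective_module F -> injdim_le m M -> injdim_le m (F * M)%type.
Proof.
move=> injF.
have injP (E : lmodType R) : injective_module E -> injective_module (F *
  E)%type.
  move=> injE A B i f inji.
  have f1L : linear (fun x => (f x).1) by move=> a x y; rewrite linearP.
  have f2L : linear (fun x => (f x).2) by move=> a x y; rewrite linearP.
  have [g1 g1P] := injF _ _ i (linear_map f1L) inji.
  have [g2 g2P] := injE _ _ i (linear_map f2L) inji.
  have gL : linear (fun y => (g1 y, g2 y)).
    by move=> a x y; rewrite !linearP.
  exists (linear_map gL) => x; rewrite linear_mapE g1P g2P !linear_mapE.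
  by rewrite -surjective_pairing.
case: m M => [|m] M /=; first exact: injP.
move=> [E [C [i [p [injE inji ip pC Cm]]]]].
have iL : linear (fun x : F * M => (x.1, i x.2)).
  by move=> a x y; rewrite /= linearP.
have pL : linear (fun x : F * E => p x.2) by move=> a x y; rewrite /= linearP.
exists (F * E)%type, C, (linear_map iL), (linear_map pL); split=> //.
- exact: injP.
- by move=> [x y] [x' y']; rewrite !linear_mapE => -[xx' /inji yy'];
    rewrite xx' yy'.
- move=> [x y]; rewrite linear_mapE /= ip; split=> [[z <-]|[[x' z] [_ <-]]].
    by exists (x, z).
  by exists z.
- by move=> z; have [x <-] := pC z; exists (0, x).
Qed.

Lemma injective_module_iso (M E : lmodType R) (i : {linear M -> E}) :
  injective_module E -> injective i -> (forall x, exists y, i y = x) ->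
  injective_module M.
Proof.
move=> injE inji surji A B j f injj.
have [h hK] := choice surji.
have fL : linear (fun x => i (f x)) by move=> a x y; rewrite !linearP.
have [g gP] := injE _ _ j (linear_map fL) injj.
have gL : linear (fun x => h (g x)).
  by move=> a x y; apply: inji; rewrite hK !linearP !hK.
exists (linear_map gL) => x; rewrite linear_mapE; apply: inji.
by rewrite hK gP linear_mapE.
Qed.

End InjectiveDimensionBound.

(** * Rings of glued triangular matrices *)

Definition gluing_matrix (K : fieldType) (H : finType) (sg : H -> H) (le : rel
  H)
    (A : H -> H -> K) : Prop :=
  (forall h u, A h u != 0 -> le u h) /\ (forall h, A (sg h) (sg h) = A h h).

(** Identifies [R] with the ring of gluing matrices through its entries alone, so that the converse
    ring satisfies the same record by transposition. *)
Record gluing_coordinates (K : fieldType) (H : finType) (sg : H -> H)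
    (le : rel H) (R : pzRingType) (co : R -> H -> H -> K) : Prop := {
  entry_inj : forall r s, (forall h u, co r h u = co s h u) -> r = s;
  entryD : forall r s h u, co (r + s) h u = co r h u + co s h u;
  entry1 : forall h u, co 1 h u = (h == u)%:R;
  entryM : forall r s h u, co (r * s) h u = \sum_w co r h w * co s w u;
  entry_gluing : forall r, gluing_matrix sg le (co r);
  entry_surj : forall A, gluing_matrix sg le A ->
    exists r, forall h u, co r h u = A h u
}.

Section GluingCoordinates.

Variables (K : fieldType) (H : finType) (sg : H -> H) (le : rel H).
Variables (R : pzRingType) (co : R -> H -> H -> K).
Hypothesis G : chain_gluing sg le.
Hypothesis C : gluing_coordinates sg le co.
Implicit Types (h u w p : H) (r s t : R).

Let sgK := gluing_sgK G.
Let lexx h : le h h := gluing_refl G h.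
Let coD := entryD C.
Let coM := entryM C.

Lemma entry0 h u : co 0 h u = 0.
Proof. by have := coD 0 0 h u; rewrite addr0 -[X in X = _]addr0 => /addrI. Qed.

Lemma entry_sum I (r : seq I) P (F : I -> R) h u :
  co (\sum_(i <- r | P i) F i) h u = \sum_(i <- r | P i) co (F i) h u.
Proof. by elim/big_rec2: _ => [|i y x _ <-]; rewrite ?entry0 ?coD. Qed.

Lemma entryB r s h u : co (r - s) h u = co r h u - co s h u.
Proof.
have := coD s (- s) h u; rewrite subrr entry0 => /esym/eqP.
by rewrite addrC addr_eq0 coD => /eqP ->.
Qed.

Lemma entry_nle r h u : ~~ le u h -> co r h u = 0.
Proof. by apply: contraNeq => /(entry_gluing C r).1. Qed.

Lemma entry_diag r h : co r (sg h) (sg h) = co r h h.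
Proof. exact: (entry_gluing C r).2. Qed.

Definition of_matrix (A : H -> H -> K) : R :=
  if pselect (exists r, forall h u, co r h u = A h u) is left e
  then projT1 (cid e) else 0.

Lemma of_matrixE A : gluing_matrix sg le A -> forall h u, co (of_matrix A) h u
  = A h u.
Proof.
move=> adm; rewrite /of_matrix; case: pselect => [e|[]];
  last exact: entry_surj C _ adm.
exact: projT2 (cid e).
Qed.

Definition scalar_elt (c : K) : R := of_matrix (fun h u => c * (h == u)%:R).

Lemma entry_scalar c h u : co (scalar_elt c) h u = c * (h == u)%:R.
Proof.
rewrite of_matrixE //; split=> [{}h {}u|{}h]; last by rewrite !eqxx.
by have [->|] := eqVneq h u; rewrite ?lexx // mulr0 eqxx.
Qed.

Lemma scalarD : {morph scalar_elt : a b / a + b}.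
Proof.
by move=> a b; apply: (entry_inj C) => h u; rewrite coD !entry_scalar mulrDl.
Qed.

Lemma scalarM : {morph scalar_elt : a b / a * b}.
Proof.
move=> a b; apply: (entry_inj C) => h u; rewrite coM !entry_scalar.
rewrite (bigD1 h) //= big1 => [|w wh];
  rewrite !entry_scalar ?eqxx ?mulr1 ?addr0 ?mulrA //.
by rewrite eq_sym (negPf wh) mulr0 !mul0r.
Qed.

Lemma scalar1 : scalar_elt 1 = 1.
Proof.
by apply: (entry_inj C) => h u; rewrite entry_scalar (entry1 C) mul1r.
Qed.

Lemma scalar0 : scalar_elt 0 = 0.
Proof.
by apply: (entry_inj C) => h u; rewrite entry_scalar entry0 mul0r.
Qed.

Definition scalar_rmorphism : {rmorphism K -> R} :=
  HB.pack scalar_elt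
    (GRing.isNmodMorphism.Build K R scalar_elt (scalar0, scalarD))
    (GRing.isMonoidMorphism.Build K R scalar_elt (scalar1, scalarM)).

Lemma entry_scalarM c r h u : co (scalar_elt c * r) h u = c * co r h u.
Proof.
rewrite coM (bigD1 h) //= big1 => [|w wh];
  rewrite entry_scalar ?eqxx ?mulr1 ?addr0 //.
by rewrite eq_sym (negPf wh) mulr0 !mul0r.
Qed.

Lemma entry_Mscalar c r h u : co (r * scalar_elt c) h u = c * co r h u.
Proof.
rewrite coM (bigD1 u) //= big1 => [|w wh];
  rewrite entry_scalar ?eqxx ?mulr1 ?addr0 1?mulrC //.
by rewrite (negPf wh) mulr0 mul0r.
Qed.

Lemma scalar_comm c r : scalar_elt c * r = r * scalar_elt c.
Proof. by apply: (entry_inj C) => h u; rewrite entry_scalarM entry_Mscalar. Qed.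

(* For u < h this is the path from h to u; unit_elt h h is the idempotent of
   the vertex {h, sg h}. *)
Definition unit_elt h u : R := of_matrix (fun i w =>
  ((i == h) && (w == u) || [&& h == u, i == sg h & w == sg u])%:R).

Lemma entry_unit h u i w : le u h ->
  co (unit_elt h u) i w =
  ((i == h) && (w == u) || [&& h == u, i == sg h & w == sg u])%:R.
Proof.
move=> uh; rewrite of_matrixE //; split=> [{}i {}w|{}i].
  case E: (_ || _); rewrite /= ?eqxx // => _.
  by case/orP: E => [/andP[/eqP -> /eqP ->//]|/and3P[/eqP <- /eqP -> /eqP ->]].
rewrite !(inj_eq (can_inj sgK)) ![sg i == _](can2_eq sgK sgK).
have [<-|hu] := eqVneq h u; first by rewrite !andbb orbC.
rewrite !andFb !orbF; have [->|_] := eqVneq i h.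
  by rewrite (negPf hu) (neq_sg G).
by case: eqP => //= ->; rewrite (inj_eq (can_inj sgK)) (negPf hu).
Qed.

Lemma entry_unitM h p s u : le p h -> co (unit_elt h p * s) h u = co s p u.
Proof.
move=> ph; rewrite coM (bigD1 p) //= big1 => [|w wp];
  rewrite entry_unit // !eqxx.
  by rewrite mul1r addr0.
by rewrite (negPf wp) (neq_sg G) /= andbF mul0r.
Qed.

Lemma entry_unitM_sg h s u : co (unit_elt h h * s) (sg h) u = co s (sg h) u.
Proof.
rewrite coM (bigD1 (sg h)) //= big1 => [|w wp]; rewrite entry_unit // !eqxx.
  by rewrite orbT mul1r addr0.
by rewrite (negPf wp) (sg_neq G) /= mul0r.
Qed.

Lemma entry_unitM_neq h p s i u : le p h -> i != h -> (p == h) ==> (i != sg h)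
  ->
  co (unit_elt h p * s) i u = 0.
Proof.
move=> ph ih iph; rewrite coM big1 // => w _; rewrite entry_unit //.
rewrite (negPf ih) /= eq_sym; case: eqP iph => [->|_]; rewrite ?mul0r //=.
by move/negPf->; rewrite mul0r.
Qed.

Lemma entry_Munit h p s i : le p h -> co (s * unit_elt h p) i p = co s i h.
Proof.
move=> ph; rewrite coM (bigD1 h) //= big1 => [|w wp];
  rewrite entry_unit // !eqxx.
  by rewrite mulr1 addr0.
by rewrite (negPf wp) (neq_sg G) /= !andbF mulr0.
Qed.

Lemma entry_Munit_neq h p s i u : le p h -> p != h -> u != p ->
  co (s * unit_elt h p) i u = 0.
Proof.
move=> ph nph up; rewrite coM big1 // => w _; rewrite entry_unit //.
by rewrite (negPf up) [h == p]eq_sym (negPf nph) andbF mulr0.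
Qed.

(** The generator with [u = p] also has an entry at [sg p]: prescribing the row [p] puts [v p] on
    the diagonal at [sg p] as well. *)
Definition row_elt p (v : H -> K) : R :=
  \sum_(u | le u p) scalar_elt (v u) * unit_elt p u.

Lemma entry_row_elt p v i u :
  co (row_elt p v) i u =
  (i == p)%:R * (le u p)%:R * v u + ((i == sg p) && (u == sg p))%:R * v p.
Proof.
rewrite entry_sum.
under eq_bigr => w wp.
  rewrite entry_scalarM entry_unit //.
  have -> : ((i == p) && (u == w) || [&& p == w, i == sg p & u == sg w])%:R =
    (i == p)%:R * (u == w)%:R + (w == p)%:R * ((i == sg p) && (u == sg p))%:R
      :> K.
    rewrite [w == p]eq_sym; have [->|] := eqVneq p w; last first.
      by move=> _; rewrite mul0r addr0 orbF -natrM mulnb.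
    have [->|iw] := eqVneq i w;
      first by rewrite (neq_sg G) orbF mul1r mulr0 addr0.
    by rewrite mul0r add0r mul1r.
  rewrite mulrDr; over.
rewrite big_split /=; congr (_ + _).
  have [up|up] := boolP (le u p); last first.
    rewrite mulr0 mul0r big1 // => w wp.
    have [uw|_] := eqVneq u w; last by rewrite !mulr0.
    by rewrite uw wp in up.
  rewrite (bigD1 u) //= big1 => [|w /andP[_ wu]]; last first.
    by rewrite [u == w]eq_sym (negPf wu) !mulr0.
  by rewrite eqxx addr0 !mulr1 mulrC.
rewrite (bigD1 p) //= big1 => [|w /andP[_ wu]]; last first.
  by rewrite (negPf wu) mul0r mulr0.
by rewrite eqxx addr0 mul1r mulrC.
Qed.

(* Chooses one of h, sg h for each vertex. *)
Definition orientation h : bool := (enum_rank h < enum_rank (sg h))%N.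

Lemma orientation_sg h : orientation (sg h) = ~~ orientation h.
Proof.
rewrite /orientation sgK -leqNgt ltn_neqAle.
by rewrite (inj_eq (@ord_inj _)) (inj_eq enum_rank_inj) (sg_neq G).
Qed.

Definition orientation_sign h : K := if orientation h then 1 else -1.

Lemma sum_orientation_sign (a : H -> K) : (forall h, a (sg h) = a h) ->
  \sum_h orientation_sign h * a h = 0.
Proof.
move=> asg; rewrite (bigID orientation) /=.
rewrite [X in _ + X](reindex_inj (can_inj sgK)) /=.
rewrite [X in _ + X](eq_bigl orientation) => [|h]; last first.
  by rewrite orientation_sg negbK.
rewrite -big_split /= big1 // => h oh.
by rewrite asg /orientation_sign orientation_sg oh mul1r mulN1r subrr.
Qed.

(** Each diagonal entry is shared by the rows [h] and [sg h]; the orientation lets only one of them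
    contribute it. *)
Lemma sum_row_elt s :
  s = \sum_h row_elt h (fun u => if (u != h) || orientation h then co s h u
    else 0).
Proof.
apply: (entry_inj C) => i u; rewrite entry_sum.
under eq_bigr => h _ do rewrite entry_row_elt.
rewrite big_split /= (bigD1 i) //= big1 => [|h hi]; last first.
  by rewrite eq_sym (negPf hi) !mul0r.
rewrite (bigD1 (sg i)) //= big1 => [|h hi]; last first.
  by rewrite -[i == _](inj_eq (can_inj sgK)) sgK eq_sym (negPf hi) mul0r.
rewrite !eqxx sgK eqxx orientation_sg !addr0 mul1r /=.
have [->|ui] := eqVneq u i.
  rewrite lexx !mul1r entry_diag /=.
  by case: (orientation i); rewrite ?addr0 ?add0r.
rewrite mul0r addr0 /=; case: (boolP (le u i)) => [|/entry_nle ->];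
  rewrite ?mul1r ?mul0r //.
Qed.

End GluingCoordinates.

(** * Injective modules of functionals *)

Section FunctionalModules.

Variables (K : fieldType) (H : finType) (sg : H -> H) (le : rel H).
Variables (R : pzRingType) (co : R -> H -> H -> K).
Hypothesis G : chain_gluing sg le.
Hypothesis C : gluing_coordinates sg le co.
Implicit Types (h u w p : H) (r s t : R).

Let lexx h : le h h := gluing_refl G h.
Let iota := scalar_rmorphism G C.
Local Notation E := (unit_elt sg co).

Let iotaC c r : iota c * r = r * iota c := scalar_comm G C c r.

Definition linear_functional (f : R -> K) : Prop :=
  forall c s t, f (iota c * s + t) = c * f s + f t.

Lemma linear_functionalD f s t : linear_functional f -> f (s + t) = f s + f t.
Proof. by move=> fL; rewrite -[X in f (X + _)]mul1r -(rmorph1 iota) fL mul1r.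
  Qed.

Lemma linear_functional0 f : linear_functional f -> f 0 = 0.
Proof.
by move=> fL; have := linear_functionalD 0 0 fL;
  rewrite addr0 -[X in X = _]addr0 => /addrI.
Qed.

Lemma linear_functionalZ f c s : linear_functional f -> f (iota c * s) = c * f
  s.
Proof.
by move=> fL; rewrite -[X in f X]addr0 fL linear_functional0 // addr0.
Qed.

Lemma linear_functionalB f s t : linear_functional f -> f (s - t) = f s - f t.
Proof.
move=> fL; rewrite linear_functionalD //; congr (_ + _).
by rewrite -mulN1r -(rmorph1 iota) -rmorphN linear_functionalZ // mulN1r.
Qed.

Lemma linear_functional_sum f I (r : seq I) (P : pred I) (F : I -> R) :
  linear_functional f -> f (\sum_(i <- r | P i) F i) = \sum_(i <- r | P i) f (F
    i).
Proof.
move=> fL; elim/big_rec2: _ => [|i y x _ <-]; first exact: linear_functional0.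
exact: linear_functionalD.
Qed.

Lemma linear_functional_mull f a :
  linear_functional f -> linear_functional (fun s => f (a * s)).
Proof. by move=> fL c s t; rewrite mulrDr mulrA -iotaC -mulrA fL. Qed.

Lemma linear_functional_mulr f a :
  linear_functional f -> linear_functional (fun s => f (s * a)).
Proof. by move=> fL c s t; rewrite mulrDl -mulrA fL. Qed.

Lemma linear_functional_entry h u : linear_functional (fun s => co s h u).
Proof. by move=> c s t; rewrite (entryD C) (entry_scalarM G C). Qed.

Lemma linear_functional_lsum I (r : seq I) (P : pred I) (F : I -> R -> K) (a :
  I -> K) :
  (forall i, P i -> linear_functional (F i)) ->
  linear_functional (fun s => \sum_(i <- r | P i) F i s * a i).
Proof.
move=> FL c s t; rewrite mulr_sumr -big_split; apply: eq_bigr => i Pi /=.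
by rewrite FL // mulrDl mulrA.
Qed.

Lemma functional_row_elt f p v : linear_functional f ->
  f (row_elt sg le co p v) = \sum_(u | le u p) v u * f (E p u).
Proof.
move=> fL; rewrite linear_functional_sum //; apply: eq_bigr => u _.
exact: linear_functionalZ.
Qed.

Definition rows_zero (A : pred H) s : Prop := forall h u, A h -> co s h u = 0.

Lemma rows_zeroM A s r : rows_zero A s -> rows_zero A (s * r).
Proof.
by move=> s0 h u Ah; rewrite (entryM C) big1 // => w _; rewrite s0 ?mul0r.
Qed.

(* The families over X of K-linear functionals f x on R such that f x only
   depends on the rows in A x; R acts by (r *: f) x s = f x (s * r). *)
Section RowFunctionals.

Variables (X : Type) (A : X -> pred H).

Definition is_row_functional (f : X -> R -> K) : bool :=
  `[< forall x, linear_functional (f x) /\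
                forall s, rows_zero (A x) s -> f x s = 0 >].

Record row_functional := RowFunctional {
  row_fun :> X -> R -> K; _ : is_row_functional row_fun }.

HB.instance Definition _ := [isSub for row_fun].
HB.instance Definition _ := [Choice of row_functional by <:].

Lemma is_row_functional_zmod : zmod_closed is_row_functional.
Proof.
split=> [|f g /asboolP Ff /asboolP Fg]; apply/asboolP => x.
  by split=> // c s t; rewrite mulr0 addr0.
have [fL f0] := Ff x; have [gL g0] := Fg x; split=> [c s t|s s0].
  by rewrite /= [LHS](_ : _ = f x (iota c * s + t) - g x (iota c * s + t)) //
     fL gL [f in _ = _ * f + _](_ : _ = f x s - g x s) // mulrBr opprD addrACA.
by rewrite [LHS](_ : _ = f x s - g x s) // f0 // g0 // subrr.
Qed.

HB.instance Definition _ := GRing.SubChoice_isSubZmodule.Build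
  (X -> R -> K) is_row_functional row_functional is_row_functional_zmod.

Lemma row_funP (f : row_functional) x :
  linear_functional (f x) /\ forall s, rows_zero (A x) s -> f x s = 0.
Proof. by case: f => f /= /asboolP/(_ x). Qed.

Lemma row_fun_linear (f : row_functional) x : linear_functional (f x).
Proof. exact: (row_funP f x).1. Qed.

Lemma row_fun_eq (f : row_functional) x s t :
  (forall h u, A x h -> co s h u = co t h u) -> f x s = f x t.
Proof.
move=> st; have [fL f0] := row_funP f x.
apply/eqP; rewrite -subr_eq0 -linear_functionalB //; apply/eqP/f0 => h u Ah.
by rewrite (entryB C) st // subrr.
Qed.

Definition mk_row_functional (f : X -> R -> K) : row_functional :=
  insubd 0 f.

Lemma mk_row_functionalE f : is_row_functional f -> row_fun (mk_row_functional
  f) = f.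
Proof. by move=> ff; rewrite /mk_row_functional insubdK. Qed.

Lemma row_functionalP (f g : row_functional) :
  (forall x s, f x s = g x s) -> f = g.
Proof. by move=> fg; apply: val_inj; apply/funext => x; apply/funext => s;
  exact: fg. Qed.

Definition row_scale r (f : row_functional) : row_functional :=
  mk_row_functional (fun x s => f x (s * r)).

Lemma row_scaleE r f x s : row_scale r f x s = f x (s * r).
Proof.
rewrite mk_row_functionalE //; apply/asboolP => {}x;
  have [fL f0] := row_funP f x.
by split=> [|{}s s0]; [exact: linear_functional_mulr|apply/f0/rows_zeroM].
Qed.

Lemma row_addE (f g : row_functional) x s : (f + g) x s = f x s + g x s.
Proof. by []. Qed.

Lemma row_zeroE x s : (0 : row_functional) x s = 0.
Proof. by []. Qed.

Lemma row_scaleA a b v : row_scale a (row_scale b v) = row_scale (a * b) v.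
Proof. by apply: row_functionalP => x s; rewrite !row_scaleE mulrA. Qed.

Lemma row_scale1 : left_id 1 row_scale.
Proof. by move=> v; apply: row_functionalP => x s;
  rewrite row_scaleE mulr1. Qed.

Lemma row_scaleDr : right_distributive row_scale +%R.
Proof.
by move=> a u v; apply: row_functionalP => x s; rewrite !(row_scaleE, row_addE).
Qed.

Lemma row_scaleDl v : {morph row_scale^~ v : a b / a + b}.
Proof.
move=> a b; apply: row_functionalP => x s; rewrite !(row_scaleE, row_addE).
by rewrite mulrDr linear_functionalD //; exact: row_fun_linear.
Qed.

HB.instance Definition _ := GRing.Zmodule_isLmodule.Build R row_functional
  row_scaleA row_scale1 row_scaleDr row_scaleDl.

Lemma scale_rowE r (f : row_functional) x s : (r *: f) x s = f x (s * r).
Proof. exact: row_scaleE. Qed.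

(** The module is a product of duals over [K] of right ideals [e x * R], and linear maps from [M] to
    such a dual are functionals on [e x *: M]. A map is thus recovered from its values at 1, and
    these extend from [M] to [N] as over a field. *)
Lemma row_functional_injective : (forall x h, A x (sg h) = A x h) ->
  injective_module row_functional.
Proof.
move=> Asg M N i f inji.
(* The idempotent of the rows in [A x], a gluing matrix because [A x] is stable under [sg]. *)
pose e x := of_matrix co (fun h u => ((h == u) && A x h)%:R : K).
have eE x h u : co (e x) h u = ((h == u) && A x h)%:R.
  rewrite (of_matrixE C) //; split=> [{}h {}u|{}h]; last by rewrite !eqxx Asg.
  by have [->|] := eqVneq h u; rewrite ?lexx //= eqxx.
have eME x s h u : co (e x * s) h u = (A x h)%:R * co s h u.
  rewrite (entryM C) (bigD1 h) //= big1 => [|w wh]; rewrite eE.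
    by rewrite eqxx addr0.
  by rewrite eq_sym (negPf wh) mul0r.
have ext x : exists F : N -> K, (forall c n n', F (iota c *: n + n') = c * F n
  + F n') /\
    forall m, F (i m) = f m x 1.
  apply: functional_extension_along => // c m m'.
  rewrite linearP row_addE scale_rowE mul1r -[X in row_fun (f m) x X]mulr1.
  by rewrite (linear_functionalZ _ _ (row_fun_linear _ _)).
have [F FP] := choice ext.
have FL x := (FP x).1; have FE x := (FP x).2.
have FD x n n' : F x (n + n') = F x n + F x n'.
  by have := FL x 1 n n'; rewrite rmorph1 scale1r mul1r.
have F0 x : F x 0 = 0.
  by have := FD x 0 0; rewrite addr0 -[X in X = _]addr0 => /addrI.
have FZ x c n : F x (iota c *: n) = c * F x n.
  by have := FL x c n 0; rewrite !addr0 F0 addr0.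
have gP n : is_row_functional (fun x s => F x ((e x * s) *: n)).
  apply/asboolP => x; split=> [c s t|s s0].
    by rewrite mulrDr mulrA -iotaC -mulrA scalerDl -scalerA FL.
  rewrite [e x * s](_ : _ = 0) ?scale0r ?F0 //; apply: (entry_inj C) => h u.
  rewrite eME (entry0 C); case: (boolP (A x h)) => [Ah|_]; rewrite ?mul0r //.
  by rewrite s0 // mulr0.
have gL : linear (fun n => mk_row_functional (fun x s => F x ((e x * s) *: n))).
  move=> r n n'; apply: row_functionalP => x s.
  rewrite row_addE scale_rowE !mk_row_functionalE // scalerDr FD.
  by rewrite scalerA mulrA.
exists (linear_map gL) => m; apply: row_functionalP => x s.
rewrite linear_mapE mk_row_functionalE // -linearZ FE linearZ scale_rowE mul1r.
by apply: row_fun_eq => h u Ah; rewrite eME Ah mul1r.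
Qed.

End RowFunctionals.

End FunctionalModules.

(** * Resolution of the functionals on one row *)

Section InjectiveResolution.

Variables (K : fieldType) (H : finType) (sg : H -> H) (le : rel H).
Variables (R : pzRingType) (co : R -> H -> H -> K).
Hypothesis G : chain_gluing sg le.
Hypothesis C : gluing_coordinates sg le co.
Implicit Types (h u w p : H) (r s t : R) (o : option H).

Let sgK := gluing_sgK G.
Local Notation E := (unit_elt sg co).
Local Notation linear_functional := (linear_functional G C).
Local Notation row_functional := (row_functional G C).
Local Notation is_row_functional := (is_row_functional G C).
Local Notation mk_row_functional := (mk_row_functional G C).

Lemma row_functional_expand f p s : linear_functional f ->
  (forall s, rows_zero co (pred1 p) s -> f s = 0) ->
  f s = \sum_(u | le u p) co s p u * f (E p u).
Proof.
move=> fL f0; rewrite -(functional_row_elt _ _ fL).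
apply/eqP; rewrite -subr_eq0 -(linear_functionalB _ _ fL); apply/eqP/f0.
move=> h u /eqP ->; rewrite (entryB C) (entry_row_elt G C) eqxx (neq_sg G).
rewrite !mul1r mul0r addr0; have [up|/(entry_nle C) ->] := boolP (le u p).
  by rewrite mul1r subrr.
by rewrite mulr0 subrr.
Qed.

(** [None] encodes the zero module. Families over [X] treat all factors of a product in a single
    exact sequence. *)
Definition opt_set o : pred H := fun h => o == Some h.
Definition opt_hull o : pred H := fun h => (o == Some h) || (o == Some (sg h)).
Definition opt_next o : option H := obind (fun h => chain_pred le (sg h)) o.
(** Left multiplication by this arrow copies the row [p] into the row [sg h]; composing functionals
    with it gives the map onto J{p}. *)
Definition opt_next_elt o : R :=
  if o is Some h then
    if chain_pred le (sg h) is Some p then E (sg h) p else 0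
  else 0.

Variable X : Type.
Implicit Type a : X -> option H.

Lemma opt_next_elt_rows o s : rows_zero co (opt_set (opt_next o)) s ->
  opt_next_elt o * s = 0.
Proof.
case: o => [h|]; rewrite /= ?mul0r //.
case hp: (chain_pred le (sg h)) => [p|]; rewrite ?mul0r // => s0.
have /(chain_predP G) cov := hp; have ph := covers_le cov.
apply: (entry_inj C) => i u; rewrite (entry0 C).
have [->|ih] := eqVneq i (sg h).
  by rewrite (entry_unitM G C) // s0 // /opt_set /=.
by rewrite (entry_unitM_neq G C) // (negPf (covers_neq cov)).
Qed.

Lemma next_is_row_functional a (f : row_functional (opt_hull \o a)) :
  is_row_functional (opt_set \o (opt_next \o a))
    (fun x s => f x (opt_next_elt (a x) * s)).
Proof.
apply/asboolP => x; split.
  by apply: linear_functional_mull; exact: row_fun_linear.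
move=> s /opt_next_elt_rows ->.
exact: (linear_functional0 (row_fun_linear f x)).
Qed.

Definition next_fun a (f : row_functional (opt_hull \o a)) :=
  mk_row_functional (opt_set \o (opt_next \o a))
    (fun x s => f x (opt_next_elt (a x) * s)).

Lemma next_funE a f x s : @next_fun a f x s = f x (opt_next_elt (a x) * s).
Proof. by rewrite mk_row_functionalE //; exact: next_is_row_functional. Qed.

Lemma next_fun_linear a : linear (@next_fun a).
Proof.
move=> r f g; apply: row_functionalP => x s.
by rewrite row_addE scale_rowE !next_funE row_addE scale_rowE mulrA.
Qed.

(** The part of the row [sg h] strictly below the diagonal is a multiple of the arrow to the
    predecessor. A functional killing such multiples sees only the diagonal entry of that row, which
    is also an entry of the row [h]. *)
Lemma next_fun_kernel a f : @next_fun a f = 0 ->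
  is_row_functional (opt_set \o a) f.
Proof.
move=> f0; apply/asboolP => x; split; first exact: row_fun_linear.
move=> s s0; have := row_fun_linear f x;
  have /= fE := @row_fun_eq _ _ _ _ _ _ _ _ _ _ f x.
have {f0} f0 t : f x (opt_next_elt (a x) * t) = 0 by rewrite -next_funE f0.
move=> fL; rewrite -(linear_functional0 fL); move: f0 s0 fE.
rewrite /= /opt_hull /opt_set /rows_zero; case: (a x) => [h|] /= f0 s0 fE;
  last first.
  exact: fE.
have {}s0 u : co s h u = 0 by apply: s0.
have sgh0 u : u = sg h -> co s (sg h) u = 0 by move=> ->;
  rewrite (entry_diag C).
case hp: (chain_pred le (sg h)) f0 => [p|] f0.
  have /(chain_predP G) cov := hp; have ph := covers_le cov.
  rewrite (linear_functional0 fL) -(f0 (row_elt sg le co p (co s (sg h)))).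
  apply: fE => i u; rewrite (inj_eq Some_inj) (inj_eq Some_inj).
  case/orP => /eqP hi; rewrite -?hi.
    rewrite s0 (entry_unitM_neq G C) ?(neq_sg G) //.
    by rewrite (negPf (covers_neq cov)).
  have -> : i = sg h by rewrite hi sgK.
  rewrite (entry_unitM G C) // (entry_row_elt G C) eqxx (neq_sg G) mul0r addr0
    mul1r.
  have [|up] := boolP (le u p); first by rewrite mul1r.
  rewrite mul0r; have [/sgh0//|uh] := eqVneq u (sg h).
  by rewrite (entry_nle C) //; apply: contra up => /(covers_max cov); apply.
apply: fE => i u; rewrite (entry0 C) (inj_eq Some_inj) (inj_eq Some_inj).
case/orP => /eqP hi; first by rewrite -hi.
have -> : i = sg h by rewrite hi sgK.
have [/(chain_pred_None G hp)/sgh0//|/(entry_nle C)//] := boolP (le u (sg h)).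
Qed.

Lemma next_fun_surj a (g : row_functional (opt_set \o (opt_next \o a))) :
  exists f, @next_fun a f = g.
Proof.
(* The preimage reads in the row [sg h] what [g] reads in the row [p]. *)
pose F x s : K := if a x is Some h then
  if chain_pred le (sg h) is Some p then
    \sum_(u | le u p) co s (sg h) u * g x (E p u) else 0 else 0.
have FP : is_row_functional (opt_hull \o a) F.
  apply/asboolP => x; rewrite /F /= /opt_hull /rows_zero; case: (a x) => [h|];
    last first.
    by split=> // c s t; rewrite mulr0 addr0.
  case: (chain_pred le (sg h)) => [p|]; last first.
    by split=> // c s t; rewrite mulr0 addr0.
  split=> [|s s0].
    by apply: linear_functional_lsum => u _; exact: linear_functional_entry.
  by rewrite big1 // => u _; rewrite s0 ?mul0r // sgK eqxx orbT.
exists (mk_row_functional _ F); apply: row_functionalP => x s.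
rewrite next_funE mk_row_functionalE // /F.
have := row_funP g x; rewrite /= /opt_next_elt /opt_set /opt_next.
case: (a x) => [h|] /= [gL g0]; last by rewrite g0.
case hp: (chain_pred le (sg h)) g0 => [p|] g0; last by rewrite g0.
have /(chain_predP G) cov := hp; have ph := covers_le cov.
rewrite (row_functional_expand (p := p) s gL) => [|t t0].
  by apply: eq_bigr => u _; rewrite (entry_unitM G C).
by apply: g0 => h' u /eqP[<-]; apply: t0 => /=.
Qed.

Lemma set_is_row_functional a (f : row_functional (opt_set \o a)) :
  is_row_functional (opt_hull \o a) f.
Proof.
apply/asboolP => x; have [fL f0] := row_funP f x; split=> // s s0.
by apply: f0 => h u ah; apply: s0; apply/orP; left.
Qed.

Definition set_to_hull a (f : row_functional (opt_set \o a)) :=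
  mk_row_functional (opt_hull \o a) f.

Lemma set_to_hullE a f x s : @set_to_hull a f x s = f x s.
Proof. by rewrite mk_row_functionalE //; exact: set_is_row_functional. Qed.

Lemma set_to_hull_linear a : linear (@set_to_hull a).
Proof.
move=> r f g; apply: row_functionalP => x s.
by rewrite row_addE scale_rowE !set_to_hullE row_addE scale_rowE.
Qed.

Lemma set_to_hull_inj a : injective (@set_to_hull a).
Proof.
move=> f g fg; apply: row_functionalP => x s.
by rewrite -!set_to_hullE fg.
Qed.

Lemma next_fun_exact a f :
  @next_fun a f = 0 <-> exists g, @set_to_hull a g = f.
Proof.
split=> [/next_fun_kernel fP|[g <-]].
  exists (mk_row_functional _ f); apply: row_functionalP => x s.
  by rewrite set_to_hullE mk_row_functionalE.
apply: row_functionalP => x s; rewrite next_funE set_to_hullE row_zeroE.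
rewrite -(linear_functional0 (row_fun_linear g x)); apply: row_fun_eq => h u.
rewrite (entry0 C) /= /opt_set /opt_next_elt; case: (a x) => [k|] //= /eqP[<-].
case hp: (chain_pred le (sg k)) => [p|]; last by rewrite mul0r (entry0 C).
have /(chain_predP G) cov := hp.
rewrite (entry_unitM_neq G C) ?(neq_sg G) ?(covers_le cov) //.
by rewrite (negPf (covers_neq cov)).
Qed.

Lemma hull_injective a : injective_module (row_functional (opt_hull \o a)).
Proof. by apply: row_functional_injective => x h;
  rewrite /= /opt_hull sgK orbC. Qed.

(** Each exact sequence uses up one [opt_next]. When no next half-edge remains, the embedding into
    the hull is onto, hence the module is injective. *)
Lemma injdim_opt_set m a : (forall x, iter m.+1 opt_next (a x) = None) ->
  injdim_le m (row_functional (opt_set \o a)).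
Proof.
elim: m a => [|m IHm] a aN /=.
  apply: (injective_module_iso (i := linear_map (@set_to_hull_linear a))).
  - exact: hull_injective.
  - exact: set_to_hull_inj.
  move=> f; apply/next_fun_exact; apply: row_functionalP => x s.
  rewrite (row_funP (next_fun f) x).2 // => h u.
  by rewrite /= /opt_set [opt_next _]aN.
exists (row_functional (opt_hull \o a)), (row_functional (opt_set \o (opt_next
  \o a))).
exists (linear_map (@set_to_hull_linear a)), (linear_map (@next_fun_linear a)).
split.
- exact: hull_injective.
- exact: set_to_hull_inj.
- exact: next_fun_exact.
- exact: next_fun_surj.
by apply: IHm => x; rewrite -[RHS](aN x) [in RHS]iterSr.
Qed.

End InjectiveResolution.

(** * Resolution of the regular module *)

Section RegularModule.

Variables (K : fieldType) (H : finType) (sg : H -> H) (le : rel H).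
Variables (R : pzRingType) (co : R -> H -> H -> K).
Hypothesis G : chain_gluing sg le.
Hypothesis C : gluing_coordinates sg le co.
Implicit Types (h u w p g : H) (r s t : R).

Let lexx h : le h h := gluing_refl G h.
Local Notation E := (unit_elt sg co).
Local Notation row_functional := (row_functional G C).
Local Notation is_row_functional := (is_row_functional G C).
Local Notation mk_row_functional := (mk_row_functional G C).
Local Notation sgn := (orientation_sign K sg).
Local Notation mx := (chain_max le).

Let mxP h : le h (mx h) := (chain_maxP G h).1.

Definition max_opt h : option H := Some (mx h).
Local Notation hull := (opt_hull sg \o max_opt).
Local Notation next := (@opt_set H \o (opt_next sg le \o max_opt)).
Local Notation dual := (fun _ : unit => xpredT : pred H).

Lemma regular_is_row_functional r :
  is_row_functional hull (fun g s => co (s * r) (mx g) g).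
Proof.
apply/asboolP => g; split.
  exact: (linear_functional_mulr _ (linear_functional_entry G C _ _)).
by move=> s s0; apply: (rows_zeroM C r s0); rewrite /= /opt_hull eqxx.
Qed.

(** The factor of [g] recovers the whole column [g] of [r], because left multiplication by a unit
    carries any row of the chain to the row of its maximum. *)
Definition regular_fun (r : R^o) : row_functional hull :=
  mk_row_functional hull (fun g s => co (s * r) (mx g) g).

Lemma regular_funE r g s : regular_fun r g s = co (s * r) (mx g) g.
Proof. by rewrite mk_row_functionalE //; exact: regular_is_row_functional. Qed.

Lemma regular_fun_linear : linear regular_fun.
Proof.
move=> r x y; apply: row_functionalP => g s.
by rewrite row_addE scale_rowE !regular_funE mulrDr (entryD C) mulrA.
Qed.

Lemma regular_fun_inj : injective regular_fun.
Proof.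
move=> x y xy; apply: (entry_inj C) => u g.
have [gu|gu] := boolP (le g u); last by rewrite !(entry_nle C).
have um := chain_max_le G gu.
by rewrite -!(entry_unitM G C _ _ um) -!regular_funE xy.
Qed.

(** On the kernel of [next_fun] a family is given by coefficients [v h u]. It comes from [R] exactly
    when [v h u] vanishes for [u] strictly below [h] and [v] takes equal values at [(h, h)] and
    [(sg h, sg h)]; the signed sum tests both conditions. *)
Definition sum_fun (f : row_functional hull) : row_functional dual :=
  mk_row_functional dual (fun _ s => \sum_h sgn h * f h (E (mx h) h * s)).

Lemma sum_funE f x s : sum_fun f x s = \sum_h sgn h * f h (E (mx h) h * s).
Proof.
rewrite mk_row_functionalE //; apply/asboolP => -[]; split=> [c {}s t|{}s s0].
  rewrite mulr_sumr -big_split; apply: eq_bigr => h _ /=.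
  rewrite mulrCA -mulrDr; congr (_ * _).
  exact: (linear_functional_mull (E (mx h) h) (row_fun_linear f h)).
rewrite big1 // => h _; have -> : s = 0.
  by apply: (entry_inj C) => u w; rewrite s0 // (entry0 C).
by rewrite mulr0 (linear_functional0 (row_fun_linear f h)) mulr0.
Qed.

Lemma sum_fun_linear : linear sum_fun.
Proof.
move=> r f g; apply: row_functionalP => x s.
rewrite row_addE scale_rowE !sum_funE -big_split; apply: eq_bigr => h _.
by rewrite row_addE scale_rowE mulrDr mulrA.
Qed.

Definition coker_fun (f : row_functional hull) :
    (row_functional dual * row_functional next)%type :=
  (sum_fun f, next_fun f).

Lemma coker_fun_linear : linear coker_fun.
Proof.
by move=> r f g; rewrite /coker_fun sum_fun_linear next_fun_linear.
Qed.

Lemma sum_fun_row (v : H -> H -> K) (f : row_functional hull) x s :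
  (forall h s, f h s = \sum_(u | le u (mx h)) co s (mx h) u * v h u) ->
  sum_fun f x s = \sum_h sgn h * \sum_(u | le u h) co s h u * v h u.
Proof.
move=> fE; rewrite sum_funE; apply: eq_bigr => h _; congr (_ * _); rewrite fE.
rewrite (bigID (fun u => le u h)) /= [X in _ + X]big1 => [|u /andP[_ uh]];
  last first.
  by rewrite (entry_unitM G C) // (entry_nle C) // mul0r.
rewrite addr0; apply: eq_big => u.
  by case: (boolP (le u h)) => [uh|]; rewrite ?andbF // (gluing_trans G uh).
by rewrite (entry_unitM G C).
Qed.

Lemma coker_fun_regular r : coker_fun (regular_fun r) = 0.
Proof.
congr (_, _); apply: row_functionalP => x s.
  rewrite sum_funE row_zeroE.
  rewrite -[RHS](sum_orientation_sign G (fun h => entry_diag C (s * r) h)).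
  apply: eq_bigr => h _; congr (_ * _).
  by rewrite regular_funE -mulrA (entry_unitM G C).
rewrite next_funE row_zeroE regular_funE /opt_next_elt /=.
case hp: (chain_pred le (sg (mx x))) => [p|]; last by rewrite !mul0r (entry0 C).
have /(chain_predP G) cov := hp.
rewrite -mulrA (entry_unitM_neq G C) ?(neq_sg G) ?(covers_le cov) //.
by rewrite (negPf (covers_neq cov)).
Qed.

Lemma coker_fun_kernel f : coker_fun f = 0 -> exists r, regular_fun r = f.
Proof.
move=> f0; have sum0 : sum_fun f = 0 by have := congr1 fst f0.
have next0 : next_fun f = 0 by have := congr1 snd f0.
pose v h u := f h (E (mx h) u).
have fE h s : f h s = \sum_(u | le u (mx h)) co s (mx h) u * v h u.
  have /asboolP/(_ h)[fL fr] := next_fun_kernel next0.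
  rewrite (row_functional_expand (p := mx h) s fL) // => t t0.
  by apply: fr => k u /eqP[<-]; apply: t0 => /=.
have sumE s : \sum_h sgn h * \sum_(u | le u h) co s h u * v h u = 0.
  by rewrite -(sum_fun_row tt s fE) sum0.
have sgn_neq0 h : sgn h != 0.
  by rewrite /orientation_sign; case: ifP; rewrite ?oppr_eq0 oner_eq0.
(* Evaluation at [E k w] isolates one coefficient; evaluation at [E k k] below leaves the two glued
   diagonal terms with opposite signs. *)
have v0 k w : le w k -> w != k -> v k w = 0.
  move=> wk nwk; have := sumE (E k w).
  rewrite (bigD1 k) //= (bigD1 w) //= big1 => [|u /andP[_ uw]]; last first.
    by rewrite (entry_unit G C) // (negPf uw) eq_sym (negPf nwk) andbF mul0r.
  rewrite big1 => [|h hk]; last first.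
    rewrite big1 ?mulr0 // => u _; rewrite (entry_unit G C) // (negPf hk).
    by rewrite [k == w]eq_sym (negPf nwk) mul0r.
  rewrite (entry_unit G C) // !eqxx mul1r !addr0 => /eqP.
  by rewrite mulf_eq0 (negPf (sgn_neq0 k)) => /eqP.
have vd k : v (sg k) (sg k) = v k k.
  have := sumE (E k k).
  have kD i u : co (E k k) i u = ((i == k) && (u == k) || (i == sg k) && (u ==
    sg k))%:R.
    by rewrite (entry_unit G C) // eqxx.
  have rowD i : (i == k) || (i == sg k) ->
      \sum_(u | le u i) co (E k k) i u * v i u = v i i.
    move=> ik; rewrite (bigD1 i) //= big1 => [|u /andP[_ ui]]; rewrite kD.
      by case/orP: ik => /eqP ->;
        rewrite ?eqxx ?(neq_sg G) ?(sg_neq G) /= mul1r addr0.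
    by case/orP: ik ui => /eqP -> /negPf ->;
      rewrite ?eqxx ?(neq_sg G) ?(sg_neq G) /= mul0r.
  rewrite (bigD1 k) //= rowD ?eqxx // (bigD1 (sg k)) ?(sg_neq G) //= rowD ?eqxx
    ?orbT //.
  rewrite big1 => [|h /andP[hk hsk]]; last first.
    by rewrite big1 ?mulr0 // => u _; rewrite kD (negPf hk) (negPf hsk) mul0r.
  rewrite addr0 /orientation_sign (orientation_sg G).
  case: (orientation _ k); rewrite /= !(mul1r, mulN1r).
    by move=> /eqP; rewrite subr_eq0 => /eqP.
  by rewrite addrC => /eqP; rewrite subr_eq0 => /eqP.
pose A u h := if le h u then v h u else 0.
have AE : gluing_matrix sg le A.
  split=> [u h|h]; first by rewrite /A; case: ifP; rewrite ?eqxx.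
  by rewrite /A !lexx.
exists (of_matrix co A); apply: row_functionalP => g s.
rewrite regular_funE fE (entryM C).
rewrite [LHS](bigID (fun u => le u (mx g))) /= [X in _ + X]big1 => [|u um];
  last first.
  by rewrite (entry_nle C) // mul0r.
rewrite addr0; apply: eq_bigr => u um; rewrite (of_matrixE C AE) /A.
case: ifP => // gu; congr (_ * _); rewrite v0 //.
  by have := gluing_down G um (mxP g); rewrite gu orbF.
by apply: contraFneq gu => ->.
Qed.

Lemma coker_fun_surj z : exists f, coker_fun f = z.
Proof.
(* After subtracting a lift of [y], it remains to reach the dual component from within the kernel of
   [next_fun]. *)
case: z => alpha y; have [psi psiE] := next_fun_surj y.
suff [phi [phi1 phi2]] : exists phi, sum_fun phi = alpha - sum_fun psi /\
  next_fun phi = 0.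
  exists (phi + psi); rewrite /coker_fun -[phi]scale1r sum_fun_linear
    next_fun_linear.
  by rewrite !scale1r phi1 phi2 psiE add0r subrK.
move: {psiE} (alpha - _) => beta.
(* The coefficients are signed values of [beta] on units; as in [sum_row_elt], only one of [h] and
   [sg h] receives the diagonal value. *)
pose v h u := sgn h * (if (u != h) || orientation sg h then beta tt (E h u)
  else 0).
pose F h s := \sum_(u | le u (mx h)) co s (mx h) u * v h u.
have FP : is_row_functional hull F.
  apply/asboolP => h; split=> [|s s0].
    by apply: linear_functional_lsum => u _; exact: linear_functional_entry.
  by rewrite /F big1 // => u _; rewrite s0 ?mul0r // /= /opt_hull eqxx.
have FE h s : mk_row_functional hull F h s = F h s by rewrite
  mk_row_functionalE.
exists (mk_row_functional hull F); split; apply: row_functionalP => x s;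
  last first.
  rewrite next_funE FE row_zeroE /F big1 // => u _ /=.
  case hp: (chain_pred le (sg (mx x))) => [p|];
    last by rewrite mul0r (entry0 C) mul0r.
  have /(chain_predP G) cov := hp.
  rewrite (entry_unitM_neq G C) ?mul0r ?(neq_sg G) ?(covers_le cov) //.
  by rewrite (negPf (covers_neq cov)).
case: x; rewrite (sum_fun_row tt s FE) [in RHS](sum_row_elt G C s).
have bL := row_fun_linear beta tt.
rewrite (linear_functional_sum _ _ _ bL); apply: eq_bigr => h _.
rewrite (functional_row_elt _ _ bL) mulr_sumr; apply: eq_bigr => u uh.
have sgnK : sgn h * sgn h = 1.
  by rewrite /orientation_sign; case: ifP; rewrite ?mulrNN !mulr1.
rewrite /v mulrCA [sgn h * (_ * _)]mulrA sgnK mul1r.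
by case: ifP; rewrite ?mulr0 ?mul0r.
Qed.

(** The embedding of [R] accounts for one degree and one [opt_next]; [injdim_opt_set] handles the
    factor [next]. *)
Lemma injdim_regular m :
  (forall g, iter m.+2 (opt_next sg le) (Some (mx g)) = None) ->
  injdim_le m.+1 (R^o : lmodType R).
Proof.
move=> nextN /=.
exists (row_functional hull), (row_functional dual * row_functional next)%type.
exists (linear_map regular_fun_linear), (linear_map coker_fun_linear); split.
- exact: hull_injective.
- exact: regular_fun_inj.
- move=> f; split; first exact: coker_fun_kernel.
  by move=> [r <-]; exact: coker_fun_regular.
- exact: coker_fun_surj.
apply: injdim_le_prod; first exact: row_functional_injective.
by apply: injdim_opt_set => g; rewrite -[RHS](nextN g) [in RHS]iterSr.
Qed.

End RegularModule.

(** * A lower bound from exact complexes of projectives *)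

Section ProjectiveComplex.

Variables (R : pzRingType) (e a : nat -> R) (N : nat).
Hypothesis ee : forall j, e j * e j = e j.
Hypothesis ea : forall j, (j < N)%N -> e j * a j = a j.
Hypothesis ae : forall j, (j < N)%N -> a j * e j.+1 = a j.
Hypothesis aa : forall j, (j.+1 < N)%N -> a j * a j.+1 = 0.

(* [r |-> r * a j] maps R e_j to R e_(j+1). *)
Definition exact_at (j : nat) : Prop := forall r, r * a j = 0 ->
  if j is j'.+1 then exists s, r * e j = s * a j' else r * e j = 0.

Hypothesis exa : forall j, (j < N)%N -> exact_at j.

(** Elements fixed by [e j] are the maps from [R e_j] to [M]; the second condition says that the map
    vanishes on the image of the preceding projective. *)
Definition cocycle (M : lmodType R) j (y : M) : Prop :=
  e j *: y = y /\ (if j is j'.+1 then a j' *: y = 0 else True).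

(** By exactness, sending [r * a j] to [r *: y] is well defined on the left ideal generated by
    [a j]; injectivity extends it to [R]. *)
Lemma injective_cocycle (M : lmodType R) j (y : M) :
  injective_module M -> (j < N)%N -> cocycle j y ->
  exists g, e j.+1 *: g = g /\ a j *: g = y.
Proof.
move=> injM jN [ey ay].
pose S (x : R^o) := exists r, r * a j = x.
have [|f fP] := @choice R^o M (fun x z => S x -> forall r, r * a j = x -> r *:
  y = z).
  move=> x; have [[r rx]|nS] := pselect (S x); last by exists 0 => /nS.
  exists (r *: y) => _ r' r'x; apply/eqP; rewrite -subr_eq0 -scalerBl.
  have ra : (r' - r) * a j = 0 by rewrite mulrBl r'x rx subrr.
  have := exa jN ra; rewrite -ey scalerA; move: ay.
  by case: j {jN ey S rx r'x ra} => [_ ->|j ay [s ->]];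
    rewrite ?scale0r // -scalerA ay scaler0.
have fE r : f (r * a j) = r *: y.
  by rewrite (fP (r * a j) _ r) //; exists r.
have [||c _ _ [r <-] [s <-]|g gP] := @injective_extension_of R R^o S _ _ M f
  injM.
- by exists 0; rewrite mul0r.
- by move=> c _ _ [r <-] [s <-]; exists (c * r + s); rewrite mulrDl -mulrA.
- rewrite [c *: _]mulrA -mulrDl !fE scalerDl scalerA //.
exists (e j.+1 *: g 1); split; first by rewrite scalerA ee.
rewrite scalerA ae // -linearZ [a j *: _]mulr1 gP; last by exists 1;
  rewrite mul1r.
by rewrite -[X in f X]mul1r fE scale1r.
Qed.

(** A chase in the double complex of maps from the projectives to the resolution: follow the
    diagonal until the resolution has ended, then correct each lift on the way back. *)
Lemma resolution_cocycle (E : nat -> lmodType R)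
    (delta : forall i, {linear E i -> E i.+1}) m d i j (y : E i) :
  (forall i, injective_module (E i)) ->
  (forall i x, delta i.+1 x = 0 <-> exists y, delta i y = x) ->
  (forall i, (m < i)%N -> forall x : E i, x = 0) ->
  (m <= i + d)%N -> (j + d < N)%N -> delta i y = 0 -> cocycle j y ->
  exists g, [/\ delta i g = 0, e j.+1 *: g = g & a j *: g = y].
Proof.
move=> injE exE E0; elim: d i j y => [|d IHd] i j y.
  rewrite !addn0 => mi jN dy cy;
    have [g [eg ag]] := injective_cocycle (injE i) jN cy.
  by exists g; split=> //; apply: E0; rewrite ltnS.
rewrite !addnS => mi jN dy cy.
have jN' : (j < N)%N by apply: leq_ltn_trans (leq_addr d j) (ltnW jN).
have [g [eg ag]] := injective_cocycle (injE i) jN' cy.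
have [||||c [dc ec ac]] := IHd i.+1 j.+1 (delta i g) => //.
- by apply/exE; exists g.
- by split; rewrite -linearZ ?eg // ag.
have /exE[l lc] := dc.
(* Since [a j.+1 *: c = delta i g], the corrected lift is in the kernel, and [aa] keeps its multiple
   by [a j] unchanged. *)
exists (g - a j.+1 *: l); split.
- by rewrite linearB linearZ /= lc ac subrr.
- by rewrite scalerBr eg scalerA ea // (leq_ltn_trans _ jN) // ltnS leq_addr.
- by rewrite scalerBr scalerA aa ?scale0r ?subr0 // (leq_ltn_trans _ jN) //
    ltnS leq_addr.
Qed.

(** The lift of [eta (e 0)] given by the chase is killed by [delta 0], so it comes from some [y] in
    [R] with [a 0 * y = e 0]. *)
Lemma resolution_length_ge m :
  (0 < N)%N -> (forall y, a 0 * y <> e 0) ->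
  has_injective_resolution (R^o : lmodType R) m -> (N <= m)%N.
Proof.
move=> N0 ae0 [E [eta [delta [[injeta exeta] exdelta injE E0]]]].
rewrite leqNgt; apply/negP => mN.
have [||g [dg _ ag]] := @resolution_cocycle E delta m m 0 0 (eta (e 0)) injE
  exdelta E0
    (leqnn _) mN.
- by apply/exeta; exists (e 0).
- by split=> //; rewrite -linearZ; congr (eta _); exact: ee.
have /exeta[y yg] := dg; apply: (ae0 y); apply: injeta.
by rewrite -ag -yg -linearZ.
Qed.

End ProjectiveComplex.

(** * The complex of projectives along a walk *)

Section LowerBound.

Variables (K : fieldType) (H : finType) (sg : H -> H) (le : rel H).
Variables (R : pzRingType) (co : R -> H -> H -> K).
Hypothesis G : chain_gluing sg le.
Hypothesis C : gluing_coordinates sg le co.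
Implicit Types (h u w p : H) (r s t : R).

Let sgK := gluing_sgK G.
Let lexx h : le h h := gluing_refl G h.
Local Notation E := (unit_elt sg co).

Lemma entry_vertexM h s i u :
  co (E h h * s) i u = if (i == h) || (i == sg h) then co s i u else 0.
Proof.
have [->|ih] := eqVneq i h; first by rewrite (entry_unitM G C).
have [->|ish] := eqVneq i (sg h); first by rewrite (entry_unitM_sg G C).
by rewrite (entry_unitM_neq G C) // ish implybT.
Qed.

Lemma entry_Mvertex h s i u :
  co (s * E h h) i u = if (u == h) || (u == sg h) then co s i u else 0.
Proof.
have [->|uh] := eqVneq u h; first by rewrite (entry_Munit G C).
rewrite (entryM C); have [->|ush] := eqVneq u (sg h).
  rewrite (bigD1 (sg h)) //= big1 => [|w wh]; rewrite (entry_unit G C) // !eqxx.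
    by rewrite orbT mulr1 addr0.
  by rewrite (negPf wh) (sg_neq G) andbF mulr0.
rewrite big1 // => w _; rewrite (entry_unit G C) // (negPf uh) (negPf ush).
by rewrite !andbF mulr0.
Qed.

Lemma vertex_idem h : E h h * E h h = E h h.
Proof.
apply: (entry_inj C) => i u; rewrite entry_vertexM (entry_unit G C) //.
by case: ifP => // /norP[/negPf-> /negPf->]; rewrite andbF.
Qed.

Lemma vertex_pathM h p : le p h -> p != h -> E h h * E h p = E h p.
Proof.
move=> ph nph; apply: (entry_inj C) => i u;
  rewrite entry_vertexM (entry_unit G C) //.
by rewrite [h == p]eq_sym (negPf nph) orbF; case: ifP => // /norP[/negPf->].
Qed.

Lemma path_vertexM h p : le p h -> p != h -> E h p * E (sg p) (sg p) = E h p.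
Proof.
move=> ph nph; apply: (entry_inj C) => i u;
  rewrite entry_Mvertex (entry_unit G C) //.
rewrite sgK [h == p]eq_sym (negPf nph) orbF.
by case: ifP => // /norP[_ /negPf->]; rewrite andbF.
Qed.

Lemma path_pathM h p q : le p h -> p != h -> le q (sg p) -> q != sg p ->
  E h p * E (sg p) q = 0.
Proof.
move=> ph nph qp nqp; apply: (entry_inj C) => i u; rewrite (entry0 C).
have [->|ih] := eqVneq i h;
  last by rewrite (entry_unitM_neq G C) // (negPf nph).
rewrite (entry_unitM G C) // (entry_unit G C) //.
by rewrite (neq_sg G) [sg p == q]eq_sym (negPf nqp).
Qed.

(** The equation clears the column [h] of [r]. As [sg h] is maximal, its column has only the
    diagonal entry, which is shared with the column [h]. *)
Lemma kernel_maximal h r p : le p h -> p != h ->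
  (forall u, le (sg h) u -> u = sg h) -> r * E h p = 0 -> r * E h h = 0.
Proof.
move=> ph nph hmax rE; have rh i : co r i h = 0.
  by rewrite -(entry_Munit G C _ _ ph) rE (entry0 C).
apply: (entry_inj C) => i u; rewrite entry_Mvertex (entry0 C).
case: ifP => // /orP[] /eqP -> //.
have [/hmax ->|/(entry_nle C) //] := boolP (le (sg h) i).
by rewrite (entry_diag C).
Qed.

Lemma kernel_covers h q r p : covers le q (sg h) -> le p h -> p != h ->
  r * E h p = 0 -> exists s, r * E h h = s * E q (sg h).
Proof.
move=> cov ph nph rE; have rh i : co r i h = 0.
  by rewrite -(entry_Munit G C _ _ ph) rE (entry0 C).
have hq := covers_le cov; have nhq := covers_neq cov.
(* The column [sg h] of [r] vanishes on the diagonal, so it is supported from [q] upwards and can be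
   moved to the column [q]; the entry at [sg q] restores equal diagonal entries. *)
pose A i w := if (w == q) && le q i then co r i (sg h)
              else if (i == sg q) && (w == sg q) then co r q (sg h) else 0.
have AE : gluing_matrix sg le A.
  split=> [i w|i]; rewrite /A.
    case: ifP => [/andP[/eqP->]//|_].
    by case: ifP => [/andP[/eqP-> /eqP->]//|_]; rewrite eqxx.
  have [->|iq] := eqVneq i q; first by rewrite (sg_neq G) !eqxx lexx.
  rewrite (inj_eq (can_inj sgK)) (negPf iq) /=.
  have [->|isq] := eqVneq i (sg q); first by rewrite sgK eqxx lexx.
  by rewrite (can2_eq sgK sgK) (negPf isq).
exists (of_matrix co A); apply: (entry_inj C) => i u; rewrite entry_Mvertex.
have [->|ush] := eqVneq u (sg h); last first.
  rewrite orbF (entry_Munit_neq G C) //.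
  by case: eqP => // ->; rewrite rh.
rewrite orbT (entry_Munit G C) // (of_matrixE C AE) /A eqxx /=.
have [//|qi] := boolP (le q i); rewrite (neq_sg G) andbF.
have [hi|/(entry_nle C)//] := boolP (le (sg h) i).
have iq : le i q by have := gluing_up G hq hi; rewrite (negPf qi).
have niq : i != q by apply: contraNneq qi => ->.
have -> : i = sg h by apply: (gluing_anti G); rewrite hi (covers_max cov).
by rewrite (entry_diag C).
Qed.

(** The row [h] of the product is the row [p] of [y], whose entry at [h] vanishes because [h] is
    above [p]. *)
Lemma path_not_right_divisor h p y : le p h -> p != h -> E h p * y <> E h h.
Proof.
move=> ph nph /(congr1 (fun r => co r h h)); rewrite (entry_unitM G C) //.
rewrite (entry_unit G C) // eqxx (entry_nle C) => [/eqP|];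
  first by rewrite eq_sym oner_eq0.
by apply: contra nph => hp; apply/eqP/(gluing_anti G); rewrite ph hp.
Qed.

Lemma injective_resolution_ge (c : nat -> H) N m : (0 < N)%N ->
  (forall j, (j < N)%N -> covers le (c j) (sg (c j.+1))) ->
  (forall u, le (sg (c 0)) u -> u = sg (c 0)) ->
  has_injective_resolution (R^o : lmodType R) m -> (N <= m)%N.
Proof.
move=> N0 cov cmax.
apply: (@resolution_length_ge R (fun j => E (c j) (c j))
  (fun j => E (c j) (sg (c j.+1)))) => // [j|j jN|j jN|j jN|j jN|y].
- exact: vertex_idem.
- by rewrite vertex_pathM ?(covers_le (cov j jN)) ?(covers_neq (cov j jN)).
- rewrite -[X in _ * E X X]sgK path_vertexM //.
    exact: (covers_le (cov j jN)).
  exact: (covers_neq (cov j jN)).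
- have c1 := cov _ (ltnW jN); have c2 := cov _ jN.
  rewrite -[X in _ * E X _]sgK path_pathM ?sgK //; try exact: (covers_le c1);
    try exact: (covers_neq c1); try exact: (covers_le c2);
      exact: (covers_neq c2).
- have cj := cov _ jN => r rE.
  case: j jN cj rE => [|j] jN cj rE.
    by apply: kernel_maximal rE => //;
      [exact: covers_le cj|exact: covers_neq cj].
  apply: (@kernel_covers _ _ r _ (cov _ (ltnW jN)) _ _ rE).
    exact: covers_le cj.
  exact: covers_neq cj.
- by apply: path_not_right_divisor;
    [exact: covers_le (cov 0 N0)|exact: covers_neq (cov 0 N0)].
Qed.

End LowerBound.

Lemma converse_coordinates (K : fieldType) (H : finType) (sg : H -> H)
    (le : rel H) (R : pzRingType) (co : R -> H -> H -> K) :
  gluing_coordinates sg le co ->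
  gluing_coordinates sg (fun u h => le h u) (fun (r : R^c) h u => co r u h).
Proof.
move=> C; split.
- by move=> r s rs; apply: (entry_inj C) => h u; exact: rs.
- by move=> r s h u; exact: entryD C _ _ _ _.
- by move=> h u; rewrite (entry1 C) eq_sym.
- move=> r s h u; rewrite [LHS](entryM C (s : R) (r : R)).
  by apply: eq_bigr => w _; exact: mulrC.
- move=> r; have [rle rsg] := entry_gluing C r.
  by split=> [h u|h]; [exact: rle|exact: rsg].
- move=> A [Ale Asg].
  have [r rE] : exists r, forall h u, co r h u = A u h.
    by apply: (entry_surj C); split=> [h u|h]; [exact: Ale|exact: Asg].
  by exists r => h u; exact: rE.
Qed.

Lemma injective_dimension_gluing (K : fieldType) (H : finType) (sg : H -> H)
    (le : rel H) (R : pzRingType) (co : R -> H -> H -> K) k :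
  chain_gluing sg le -> gluing_coordinates sg le co -> (1 < k)%N ->
  (forall h w, path (tile_step sg le) h w -> chain_top le (sg h) -> (size w <
    k)%N) ->
  (exists h w, [/\ path (tile_step sg le) h w, chain_top le (sg h) & (size
    w).+1 = k]) ->
  injective_dimension (R^o : lmodType R) (k - 1).
Proof.
move=> G C k1 ub [h [w [hw htop wk]]]; split; last first.
  move=> m; apply: (injective_resolution_ge G C (c := nth h (h :: w))).
  - by rewrite subn_gt0.
  - move=> j; rewrite -wk subn1 /= => jw.
    by move/pathP: hw => /(_ h j jw).
  - exact: htop.
case: k k1 ub wk => [|[|m]] // _ ub _; rewrite subn1 /=.
apply: injective_resolutionP; apply: (injdim_regular G C) => g.
apply: contrapT => iterN.
(* If the iteration went on, the opposites of its half-edges would form a walk with [k = m.+2] steps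
   starting opposite to a chain top, one step too many. The default [g] is not met up to [m.+2]. *)
pose st := fun j => odflt g (iter j (opt_next sg le) (Some (chain_max le g))).
have stE j : (j <= m.+2)%N ->
    iter j (opt_next sg le) (Some (chain_max le g)) = Some (st j).
  rewrite /st => jm; case ij: (iter j _ _) => //; case: iterN.
  by rewrite -(subnK jm) iterD ij; elim: (_ - _)%N => //= i ->.
have := ub (sg (st 0)) [seq sg (st i) | i <- iota 1 m.+2].
rewrite size_map size_iota ltnn => contra; apply: notF; apply: contra;
  last first.
  by rewrite (gluing_sgK G) => u; have := (chain_maxP G g).2 u; exact.
apply/(pathP g) => i; rewrite size_map size_iota => im.
rewrite (nth_map 0%N) ?size_iota // nth_iota // add1n.
have -> : nth g (sg (st 0) :: [seq sg (st i) | i <- iota 1 m.+2]) i = sg (st i).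
  case: i im => // i im.
  rewrite [LHS](_ : _ = nth g [seq sg (st i) | i <- iota 1 m.+2] i) //.
  by rewrite (nth_map 0%N) ?size_iota 1?ltnW // nth_iota 1?ltnW // add1n.
rewrite /tile_step (gluing_sgK G); apply/(chain_predP G).
by have := stE _ im; rewrite iterS stE 1?ltnW.
Qed.

(** For right modules, transpose the matrices and reverse the chains: walks are reversed, and ending
    at a chain bottom takes the place of starting opposite to a chain top. *)
Theorem gorenstein_dimension_gluing (K : fieldType) (H : finType) (sg : H -> H)
    (le : rel H) (R : pzRingType) (co : R -> H -> H -> K) k :
  chain_gluing sg le -> gluing_coordinates sg le co -> (1 < k)%N ->
  (forall h w, path (tile_step sg le) h w ->
     chain_top le (sg h) \/ chain_bottom le (last h w) -> (size w < k)%N) ->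
  (exists h w, [/\ path (tile_step sg le) h w, chain_top le (sg h),
     chain_bottom le (last h w) & (size w).+1 = k]) ->
  gorenstein_dimension R (k - 1).
Proof.
move=> G C k1 ub [h [w [hw htop hbot wk]]]; split.
  apply: (injective_dimension_gluing G C k1) => [g v gv gtop|].
    by apply: ub gv _; left.
  by exists h, w.
have sgsg : cancel sg sg := gluing_sgK G.
have lastE (g : H) v : last (last g v) (rev (belast g v)) = g.
  by case/lastP: v => // v z;
    rewrite last_rcons belast_rcons rev_cons last_rcons.
apply: (injective_dimension_gluing (converse_gluing G) (converse_coordinates C)
  k1).
  move=> g v; rewrite (path_tile_step_converse G) => gv gtop.
  have := ub _ _ gv; rewrite size_rev size_belast size_map; apply.
  by right; rewrite lastE.
exists (sg (last h w)), (map sg (rev (belast h w))).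
rewrite (path_tile_step_converse G) size_map size_rev size_belast wk.
have mK s : map sg (map sg s) = s by exact: mapK.
rewrite mK sgsg lastE; split=> //.
case/lastP: w hw {wk hbot} => // v z hw.
by rewrite last_rcons belast_rcons rev_cons belast_rcons rev_cons revK.
Qed.

(** * The tiling algebra *)

Section PathElements.

Variables (K : fieldType) (V : finType) (e : rel V).
Local Notation kQ := (path_algebra K e).

Lemma path_coefB (x y : kQ) q : path_coef (x - y) q = path_coef x q - path_coef
  y q.
Proof. by []. Qed.

Lemma path_coefM (x y : kQ) q : path_coef (x * y) q =
  \sum_(i < (size q.2).+1) path_coef x (q.1, take i q.2) *
     path_coef y (last q.1 (take i q.2), drop i q.2).
Proof. by []. Qed.

Lemma path_algebra_ext (x y : kQ) : (forall q, path_coef x q = path_coef y q)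
  -> x = y.
Proof. by move=> xy; apply: val_inj; apply/funext. Qed.

Lemma path_monomial (v : V) (p : seq V) (c : K) : path e v p ->
  exists x : kQ, forall q, path_coef x q = (q == (v, p))%:R * c.
Proof.
move=> vp; pose f : path_fun K e := fun q => (q == (v, p))%:R * c.
have fP : path_algebra_pred f.
  apply/asboolP; split=> [w r|].
    by rewrite /f; case: ((w, r) =P (v, p)) => [[-> ->]//|_];
      rewrite mul0r eqxx.
  exists (size p).+1 => w r pr; rewrite /f;
    case: ((w, r) =P (v, p)) => [[_ rp]|_]; last by rewrite mul0r.
  by rewrite rp ltnn in pr.
by exists (PathAlgebra fP).
Qed.

Lemma path_monomialM (v : V) p1 p2 (c d : K) (x y z : kQ) :
  (forall q, path_coef x q = (q == (v, p1))%:R * c) ->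
  (forall q, path_coef y q = (q == (last v p1, p2))%:R * d) ->
  (forall q, path_coef z q = (q == (v, p1 ++ p2))%:R * (c * d)) -> x * y = z.
Proof.
move=> xE yE zE; apply: path_algebra_ext => -[w p]; rewrite path_coefM zE /=.
have [[-> ->]|ne] := eqVneq (w, p) (v, p1 ++ p2).
  have lt1 : (size p1 < (size (p1 ++ p2)).+1)%N by rewrite ltnS size_cat
    leq_addr.
  rewrite (bigD1 (Ordinal lt1)) //= big1 => [|i ni].
    by rewrite xE yE take_size_cat // drop_size_cat // !eqxx !mul1r addr0.
  rewrite xE; case: (_ =P _) => [[ti]|_]; last by rewrite !mul0r.
  case/eqP: ni; apply: val_inj => /=; rewrite -[in RHS]ti size_takel //.
  by rewrite -ltnS ltn_ord.
rewrite mul0r big1 // => i _; rewrite xE yE.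
case: (_ =P _) => [[wv tp]|_]; last by rewrite !mul0r.
case: (_ =P _) => [[_ dp]|_]; last by rewrite mul0r mulr0.
by case/eqP: ne; rewrite wv -tp -dp cat_take_drop.
Qed.

Lemma bounded_paths N : exists s : seq (V * seq V),
  forall v p, (size p < N)%N -> (v, p) \in s.
Proof.
elim: N => [|N [s sP]]; first by exists [::].
exists ([seq (v, [::]) | v <- enum V] ++ [seq (v, q.1 :: q.2) | v <- enum V, q
  <- s]).
move=> v [|w p] pN; rewrite mem_cat; apply/orP; [left|right].
  by apply/mapP; exists v; rewrite ?mem_enum.
by apply/allpairsP; exists (v, (w, p)); rewrite mem_enum sP.
Qed.

End PathElements.

(** * Descending paths in the chains *)

Section ChainPaths.

Variables (H : finType) (sg : H -> H) (le : rel H).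
Hypothesis G : chain_gluing sg le.
Implicit Types (h u w : H) (p q : seq H).

Let lexx h : le h h := gluing_refl G h.
Local Notation cov := (covers le).

Lemma chain_path_le h p w : path cov h p -> w \in h :: p -> le w h.
Proof.
elim: p h => [|x p IHp] h /=; first by rewrite inE => _ /eqP ->.
move=> /andP[hx xp]; rewrite inE => /orP[/eqP ->//|/(IHp _ xp) wx].
exact: (gluing_trans G wx (covers_le hx)).
Qed.

Lemma chain_path_last_le h p : path cov h p -> le (last h p) h.
Proof. by move=> hp; apply: chain_path_le hp (mem_last _ _). Qed.

Lemma chain_path_uniq h p : path cov h p -> uniq (h :: p).
Proof.
elim: p h => [|x p IHp] h //= /andP[hx xp]; move: (IHp _ xp) => /= ->.
rewrite andbT; apply/negP => hxp; have hx' := chain_path_le xp hxp.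
have := covers_neq hx; rewrite (gluing_anti G (x := x) (y := h)) ?eqxx //.
by rewrite hx' (covers_le hx).
Qed.

Lemma chain_path_size_inj h p q : path cov h p -> path cov h q ->
  size p = size q -> p = q.
Proof.
elim: p h q => [|x p IHp] h [|y q] //= /andP[hx xp] /andP[hy yq] [pq].
have xy := covers_fun G hx hy; rewrite -xy in yq *.
by rewrite (IHp _ _ xp yq).
Qed.

Lemma chain_path_last_inj h p q : path cov h p -> path cov h q ->
  last h p = last h q -> p = q.
Proof.
have nil x y r : path cov x (y :: r) -> last y r = x -> False.
  move=> /chain_path_uniq /= /andP[/negP xyr _] yr; apply: xyr.
  by rewrite -[X in X \in _]yr mem_last.
elim: p h q => [|x p IHp] h [|y q] // hp hq; rewrite /= ?[h = _]eq_sym.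
- by move/esym/(nil _ _ _ hq).
- by move/(nil _ _ _ hp).
move: hp hq => /= /andP[hx xp] /andP[hy yq].
have xy := covers_fun G hx hy; rewrite -xy in yq *.
by move=> /(IHp _ _ xp yq) ->.
Qed.

Lemma chain_path_exists h u : le u h -> exists p, path cov h p /\ last h p = u.
Proof.
have [N] := ubnP #|[pred w | le w h]|.
elim: N h => // N IHN h hN uh.
have [->|nuh] := eqVneq u h; first by exists [::].
case hp: (chain_pred le h) => [x|]; last first.
  by rewrite (chain_pred_None G hp uh) eqxx in nuh.
have /(chain_predP G) hx := hp; have xh := covers_le hx.
have [||p [xp pu]] := IHN x; last by exists (x :: p); rewrite /= hx xp.
  rewrite -ltnS; apply: leq_trans hN; rewrite ltnS; apply: proper_card.
  apply/properP; split; first by apply/subsetP => w;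
    rewrite !inE => /(gluing_trans G); apply.
  exists h; rewrite !inE ?lexx //; apply: contra (covers_neq hx) => hx'.
  by apply/eqP/(gluing_anti G); rewrite xh.
exact: (covers_max hx).
Qed.

(** This path is unique; the empty list is the default when [u] is not below [h]. *)
Definition chain_path h u : seq H :=
  if pselect (exists p, path cov h p /\ last h p = u) is left ex
  then projT1 (cid ex) else [::].

Lemma chain_pathP h u : le u h ->
  path cov h (chain_path h u) /\ last h (chain_path h u) = u.
Proof.
move=> /chain_path_exists ex; rewrite /chain_path; case: pselect => // ex'.
exact: (projT2 (cid ex')).
Qed.

Lemma chain_path_eq h p : path cov h p -> chain_path h (last h p) = p.
Proof.
move=> hp; have [hq eq_last] := chain_pathP (chain_path_last_le hp).
exact: chain_path_last_inj eq_last.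
Qed.

Lemma mem_chain_path h u w : le u h -> (w \in h :: chain_path h u) = le w h &&
  le u w.
Proof.
move=> uh; have [hp pu] := chain_pathP uh.
apply/idP/andP => [wp|[wh uw]].
  split; first exact: chain_path_le wp.
  move: pu; case/splitPl: wp hp => p1 p2 wE; rewrite cat_path wE => /andP[_ wp].
  by rewrite last_cat wE => <-; apply: chain_path_last_le.
have [hq qw] := chain_pathP wh; have [hr ru] := chain_pathP uw.
have -> : chain_path h u = chain_path h w ++ chain_path w u.
  apply: (chain_path_last_inj hp); first by rewrite cat_path hq qw.
  by rewrite last_cat qw pu ru.
by rewrite -cat_cons mem_cat -[X in X \in _]qw mem_last.
Qed.

End ChainPaths.

(* The quiver obtained from the Hasse diagrams of the chains by gluing h and
   sg h into one vertex; [comp u v w] are the compositions u -> v -> w that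
   leave a chain at v. *)
Record gluing_quiver (H : finType) (sg : H -> H) (le : rel H) (V : finType)
    (vert : H -> V) (e : rel V) (comp : V -> V -> V -> Prop) : Prop := {
  vertP : forall h u, vert h = vert u <-> u = h \/ u = sg h;
  vert_surj : forall v, exists h, vert h = v;
  arrowP : forall v w, e v w <-> exists h p, [/\ covers le h p, v = vert h & w
    = vert p];
  arrow_uniq : forall h p h' p', covers le h p -> covers le h' p' ->
    vert h = vert h' -> vert p = vert p' -> h = h';
  compP : forall u v w, comp u v w <-> exists h p q,
    [/\ covers le h p, covers le (sg p) q, u = vert h, v = vert p & w = vert q]
}.

(** * Matrix entries on the quotient of the path algebra *)

Section QuiverCoordinates.

Local Open Scope quotient_scope.

Variables (K : fieldType) (H : finType) (sg : H -> H) (le : rel H) (V :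
  finType).
Variables (vert : H -> V) (e : rel V) (comp : V -> V -> V -> Prop).
Hypothesis G : chain_gluing sg le.
Hypothesis Q : gluing_quiver sg le vert e comp.
Implicit Types (h u w : H).

Local Notation cov := (covers le).
Local Notation kQ := (path_algebra K e).
Local Notation chain_path := (chain_path le).
Let lexx h : le h h := gluing_refl G h.

Definition quiver_relation (x : kQ) : Prop :=
  exists u v w : V, comp u v w /\ is_path_element u [:: v; w] x.

Local Notation A := (ideal_quotient quiver_relation).

Lemma chain_path_quiver h p : path cov h p -> path e (vert h) (map vert p).
Proof.
elim: p h => [|x p IHp] h //= /andP[hx xp]; rewrite IHp // andbT.
by apply/(arrowP Q); exists h, x.
Qed.

(** Modulo the relations, the paths that survive stay in one chain and are indexed by the pairs with
    [u] below [h]; a trivial path is indexed by both half-edges of its vertex. *)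
Definition path_entry (f : path_fun K e) h u : K :=
  if le u h then f (vert h, map vert (chain_path h u)) else 0.

(** The factorizations of a chain path correspond to the half-edges on it, which are those between
    [u] and [h]. *)
Lemma path_entryM (x y : kQ) h u : path_entry (path_coef (x * y)) h u =
  \sum_w path_entry (path_coef x) h w * path_entry (path_coef y) w u.
Proof.
rewrite {1}/path_entry; have [uh|nuh] := boolP (le u h); last first.
  rewrite big1 // => w _; rewrite /path_entry.
  case: ifP => [wh|]; last by rewrite mul0r.
  case: ifP => [uw|]; last by rewrite mulr0.
  by rewrite (gluing_trans G uw wh) in nuh.
rewrite path_coefM /= size_map; set p := chain_path h u.
have [hp pu] := chain_pathP G uh; rewrite -/p in hp pu.
have hpU := chain_path_uniq G hp.
rewrite (bigID (fun w => w \in h :: p)) /= [X in _ + X]big1 => [|w]; last first.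
  rewrite (mem_chain_path G _ uh) negb_and /path_entry.
  by case/orP => /negPf->; rewrite ?mul0r ?mulr0.
rewrite addr0 -big_uniq // (big_nth h) big_mkord; apply: eq_bigr => i _.
have ip : (i <= size p)%N by rewrite -ltnS ltn_ord.
have wi : nth h (h :: p) i = last h (take i p).
  by case: (i : nat) ip => [|j] jp;
    rewrite ?take0 //= (take_nth h jp) last_rcons.
have [hti tid] : path cov h (take i p) /\ path cov (last h (take i p)) (drop i
  p).
  by apply/andP; rewrite -cat_path cat_take_drop.
rewrite wi -map_take -map_drop last_map.
rewrite /path_entry (chain_path_last_le G hti) (chain_path_eq G hti).
have lu : last (last h (take i p)) (drop i p) = u by rewrite -last_cat
  cat_take_drop.
by rewrite -[u in le u _]lu (chain_path_last_le G tid) -[u in chain_path _ u]lu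
  (chain_path_eq G tid).
Qed.

Lemma path_entryB (x y : kQ) h u : path_entry (path_coef (x - y)) h u =
  path_entry (path_coef x) h u - path_entry (path_coef y) h u.
Proof. by rewrite /path_entry; case: ifP; rewrite ?subr0. Qed.

Lemma path_entryD (x y : kQ) h u : path_entry (path_coef (x + y)) h u =
  path_entry (path_coef x) h u + path_entry (path_coef y) h u.
Proof. by rewrite /path_entry; case: ifP; rewrite ?addr0. Qed.

Lemma path_entry0 h u : path_entry (path_coef (0 : kQ)) h u = 0.
Proof. by rewrite /path_entry; case: ifP. Qed.

(** A relation leaves its chain at the middle vertex. If it were also a chain path, [arrow_uniq]
    would make the middle half-edge equal to its opposite. *)
Lemma path_entry_relation (x : kQ) h u : quiver_relation x ->
  path_entry (path_coef x) h u = 0.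
Proof.
move=> [v1 [v2 [v3 [c [_ xE]]]]]; rewrite /path_entry; case: ifP => // uh.
rewrite xE; case: eqP => // -[h1]; have [+ _] := chain_pathP G uh.
case: (chain_path h u) => [|h2 [|h3 [|? ?]]] //= /and3P[c1 c2 _] [hv2 hv3].
have /(compP Q)[k [p [q [kp pq k1 k2 k3]]]] := c; exfalso.
have kh : h = k by apply: (arrow_uniq Q c1 kp); congruence.
rewrite -kh in kp; have ph := covers_fun G c1 kp; rewrite -ph in pq.
have : h2 = sg h2.
  apply: (arrow_uniq Q c2 pq); last congruence.
  by apply/(vertP Q); right.
by move/eqP; rewrite (neq_sg G).
Qed.

Lemma path_entry_ideal (x : kQ) h u : x \in generated_ideal quiver_relation ->
  path_entry (path_coef x) h u = 0.
Proof.
move=> /asboolP/(_ (fun x => forall h u, path_entry (path_coef x) h u = 0)).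
apply=> [|y /path_entry_relation //]; split.
- exact: path_entry0.
- by move=> y z y0 z0 k w; rewrite path_entryD y0 z0 addr0.
- move=> y z z0; split=> k w; rewrite path_entryM big1 // => j _;
    by rewrite z0 ?mul0r ?mulr0.
Qed.

(** At each vertex a path either goes on in its chain or continues with an arrow from the opposite
    half-edge, which gives a relation. *)
Lemma quiver_path_cases v p : path e v p ->
  (exists h q, [/\ path cov h q, v = vert h & p = map vert q]) \/
  (exists p1 v2 v3 p2, p = p1 ++ [:: v2, v3 & p2] /\ comp (last v p1) v2 v3).
Proof.
elim: p v => [|x p IHp] v /=.
  by move=> _; left; have [h <-] := vert_surj Q v; exists h, [::].
move=> /andP[/(arrowP Q)[h [h1 [hh1 vE xE]]] /IHp]; case; last first.
  move=> [p1 [v2 [v3 [p2 [pE c]]]]]; right.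
  by exists (x :: p1), v2, v3, p2; rewrite pE.
move=> [h2 [q [h2q xE' pE]]].
have /(vertP Q)[h2E|h2E] : vert h1 = vert h2 by rewrite -xE.
  by rewrite h2E in h2q; left; exists h, (h1 :: q); rewrite /= hh1 h2q -xE -pE.
case: q h2q pE => [|q0 q] /= h2q pE.
  by left; exists h, [:: h1]; rewrite /= hh1 -xE pE.
right; exists [::], x, (vert q0), (map vert q); rewrite pE; split=> //=.
by apply/(compP Q); exists h, h1, q0; rewrite -h2E; split=> //; case/andP: h2q.
Qed.

Lemma turning_path_ideal (J : kQ -> Prop) v p (c : K) (x : kQ) :
  two_sided_ideal J -> (forall y, quiver_relation y -> J y) ->
  path e v p -> (forall q, path_coef x q = (q == (v, p))%:R * c) ->
  (exists p1 v2 v3 p2, p = p1 ++ [:: v2, v3 & p2] /\ comp (last v p1) v2 v3) ->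
    J x.
Proof.
move=> [_ _ JM] XJ vp xE [p1 [v2 [v3 [p2 [pE c3]]]]].
move: vp; rewrite pE cat_path /= => /and4P[vp1 e12 e23 v3p2].
have [y yE] := path_monomial c vp1.
have [r rE] : exists r : kQ, forall q, path_coef r q = (q == (last v p1, [::
  v2; v3]))%:R * 1.
  by apply: path_monomial; rewrite /= e12 e23.
have [z zE] := path_monomial (1 : K) v3p2.
have Jr : J r.
  apply: XJ; exists (last v p1), v2, v3; split=> //; split;
    first by rewrite /= e12 e23.
  by move=> q; rewrite rE mulr1.
have [rz rzE] : exists t : kQ, forall q, path_coef t q =
    (q == (last v p1, [:: v2; v3] ++ p2))%:R * (1 * 1).
  by apply: path_monomial; rewrite /= e12 e23.
have -> : x = y * rz.
  symmetry; apply: (path_monomialM yE rzE) => q.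
  by rewrite xE pE !mulr1.
have <- : r * z = rz by apply: (path_monomialM rE zE) => q; rewrite rzE.
by apply: (JM _ _ _).1; apply: (JM _ _ _).2.
Qed.

(** Induction on a finite list containing the support. A path of the support cannot stay in a chain,
    as its coefficient would be an entry; so its term lies in the ideal and can be subtracted. *)
Lemma path_entry_eq0 (x : kQ) : (forall h u, path_entry (path_coef x) h u = 0)
  ->
  x \in generated_ideal quiver_relation.
Proof.
move=> x0; apply/asboolP => J idJ XJ; have [J0 JD _] := idJ.
have [s sP] : exists s : seq (V * seq V), forall q, path_coef x q != 0 -> q \in
  s.
  have := valP x => /asboolP[_ [N xN]]; have [s sP] := bounded_paths V N.
  exists s => -[v p]; apply: contraNT => /negP nvp.
  by apply/eqP/xN; rewrite leqNgt; apply/negP => /sP.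
elim: s x x0 sP => [|[v p] s IHs] x x0 sP.
  have -> // : x = 0; apply: path_algebra_ext => q.
  by apply/eqP; have := sP q; rewrite in_nil; case: eqP => // _ /(_ isT).
have [xvp0|xvp] := eqVneq (path_coef x (v, p)) 0.
  apply: IHs => // q xq; have := sP q xq; rewrite inE => /orP[/eqP qE|//].
  by rewrite qE xvp0 eqxx in xq.
have vp : path e v p by have := valP x => /asboolP[xp _]; apply: xp.
have [y yE] := path_monomial (path_coef x (v, p)) vp.
have turn : exists p1 v2 v3 p2, p = p1 ++ [:: v2, v3 & p2] /\ comp (last v p1)
  v2 v3.
  have [[h [q [hq vE pE]]]|//] := quiver_path_cases vp.
  have := x0 h (last h q).
  rewrite /path_entry (chain_path_last_le G hq) (chain_path_eq G hq) -vE -pE.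
  by move=> /eqP; rewrite (negPf xvp).
have Jy := turning_path_ideal idJ XJ vp yE turn.
rewrite -(subrK y x); apply: JD => //; apply: IHs => [h u|q].
  rewrite path_entryB x0 path_entry_ideal ?subrr //.
  by apply/asboolP => J' idJ' XJ';
    exact: turning_path_ideal idJ' XJ' vp yE turn.
rewrite path_coefB yE; have [->|nq] := eqVneq q (v, p).
  by rewrite mul1r subrr eqxx.
by rewrite mul0r subr0 => /sP; rewrite inE (negPf nq).
Qed.

Definition quiver_entry (r : A) h u : K := path_entry (path_coef (repr r)) h u.

Lemma quiver_entry_pi (x : kQ) h u :
  quiver_entry (\pi_(ideal_quotient quiver_relation) x) h u = path_entry
    (path_coef x) h u.
Proof.
apply/eqP; rewrite -subr_eq0 -path_entryB; apply/eqP/path_entry_ideal.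
by rewrite Quotient.idealrBE reprK.
Qed.

Lemma quiver_coordinates : gluing_coordinates sg le quiver_entry.
Proof.
have hhE h : chain_path h h = [::] by rewrite -[X in chain_path h X]/(last h
  [::]) (chain_path_eq G).
split.
- move=> r s rs; rewrite -[r]reprK -[s]reprK; apply/eqP.
  rewrite -Quotient.idealrBE; apply: path_entry_eq0 => h u.
  by rewrite path_entryB; apply/eqP; rewrite subr_eq0; apply/eqP/rs.
- move=> r s h u; rewrite -[r]reprK -[s]reprK quotient_piD !quiver_entry_pi.
  exact: path_entryD.
- move=> h u; have -> : (1 : A) = \pi_A 1 by [].
  rewrite quiver_entry_pi /path_entry.
  have [uh|nuh] := boolP (le u h); last first.
    by case: eqP nuh => // ->; rewrite lexx.
  rewrite [LHS]/(path_fun_one _ _ _) /path_fun_one /=.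
  have [hp pu] := chain_pathP G uh; congr (_%:R); congr nat_of_bool.
  apply/eqP/eqP => [|->]; last by rewrite hhE.
  by case: (chain_path h u) pu => //= ->.
- move=> r s h u; rewrite -[r]reprK -[s]reprK.
  rewrite [_ * _](quotient_piM) quiver_entry_pi path_entryM.
  by apply: eq_bigr => w _; rewrite !quiver_entry_pi.
- move=> r; split=> [h u|h].
    by rewrite /quiver_entry /path_entry; case: ifP; rewrite ?eqxx.
  rewrite /quiver_entry /path_entry !lexx !hhE; congr (path_coef _ (_, _)).
  by apply/(vertP Q); right; rewrite (gluing_sgK G).
move=> B [Ble Bsg].
(* Two pairs give the same path only if they are equal or both index the trivial path of a vertex,
   where [B] takes equal values. *)
pose f : path_fun K e := fun q =>
  if [pick hu : H * H | le hu.2 hu.1 &&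
        ((vert hu.1, map vert (chain_path hu.1 hu.2)) == q)] is Some hu
  then B hu.1 hu.2 else 0.
have fP : path_algebra_pred f.
  apply/asboolP; split=> [v p|].
    rewrite /f; case: pickP => [[h u] /= /andP[uh /eqP[<- <-]] _|];
      last by rewrite eqxx.
    by apply: chain_path_quiver; have [] := chain_pathP G uh.
  (* A chain path visits distinct half-edges, so its length is below [#|H|]. *)
  exists #|H| => v p Hp; rewrite /f;
    case: pickP => // -[h u] /= /andP[uh /eqP[_ pE]].
  have [hp _] := chain_pathP G uh; have hU := chain_path_uniq G hp.
  have := max_card (mem (h :: chain_path h u)); rewrite (card_uniqP hU) /=.
  by rewrite -(size_map vert) pE ltnNge Hp.
exists (\pi_A (PathAlgebra fP)) => h u; rewrite quiver_entry_pi /path_entry /=.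
case: ifP => [uh|nuh]; last first.
  by apply/esym/eqP; apply: contraFT nuh; exact: Ble.
rewrite /f; case: pickP => [[h' u'] /= /andP[u'h' /eqP[vE pE]]|]; last first.
  by move=> /(_ (h, u)); rewrite /= uh eqxx.
have [hp pu] := chain_pathP G uh; have [hp' pu'] := chain_pathP G u'h'.
have szE : size (chain_path h' u') = size (chain_path h u).
  by rewrite -(size_map vert) pE size_map.
have [h'E|ne] := eqVneq h' h.
  rewrite h'E in hp' pu' szE *; congr (B _ _); rewrite -pu -pu'.
  by rewrite (chain_path_size_inj G hp' hp szE).
case pC : (chain_path h u) (chain_path h' u') hp hp' pu pu' pE szE => [|x q]
  [|x' q'] //=.
  move=> _ _ <- <- _ _; have /(vertP Q)[hE|->] := vE; last by rewrite Bsg.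
  by rewrite hE eqxx in ne.
move=> /andP[hx _] /andP[hx' _] _ _ [xE _] _.
by rewrite (arrow_uniq Q hx' hx vE xE) eqxx in ne.
Qed.

End QuiverCoordinates.

(** The diagonal matrix of [B] is an idempotent, central because [B] is constant on chains. *)
Lemma connected_gluing (K : fieldType) (H : finType) (sg : H -> H)
    (le : rel H) (R : pzRingType) (co : R -> H -> H -> K) (B : pred H) :
  chain_gluing sg le -> gluing_coordinates sg le co -> connected_ring R ->
  (forall h, B (sg h) = B h) -> (forall h u, le u h -> B u = B h) ->
  (forall h, B h) \/ (forall h, ~~ B h).
Proof.
move=> G C [_ conn] Bsg Ble.
have lexx h : le h h := gluing_refl G h.
have [x xE] : exists x, forall h u, co x h u = ((h == u) && B h)%:R.
  apply: (entry_surj C); split=> [h u|h]; last by rewrite !eqxx Bsg.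
  by have [->|] := eqVneq h u; rewrite ?lexx //= eqxx.
have xl y h u : co (x * y) h u = (B h)%:R * co y h u.
  rewrite (entryM C) (bigD1 h) //= big1 => [|w wh]; rewrite xE.
    by rewrite eqxx addr0.
  by rewrite eq_sym (negPf wh) mul0r.
have xr y h u : co (y * x) h u = co y h u * (B u)%:R.
  rewrite (entryM C) (bigD1 u) //= big1 => [|w wh]; rewrite xE.
    by rewrite eqxx addr0.
  by rewrite (negPf wh) mulr0.
have [||x0|x1] := conn x.
- apply: (entry_inj C) => h u; rewrite xl xE.
  by case: (h == u); case: (B h); rewrite ?mulr0 ?mulr1 ?mul1r.
- move=> y; apply: (entry_inj C) => h u; rewrite xl xr mulrC.
  have [uh|/(entry_nle C) ->] := boolP (le u h); last by rewrite !mul0r.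
  by rewrite (Ble _ _ uh).
- right=> h; have := xE h h; rewrite x0 (entry0 C) eqxx /=.
  by case: (B h) => // /eqP; rewrite eq_sym oner_eq0.
- left=> h; have := xE h h; rewrite x1 (entry1 C) eqxx /=.
  by case: (B h) => // /eqP; rewrite oner_eq0.
Qed.

(** * The quiver of a tiling as glued chains *)

Section TilingQuiver.

Variables (n : nat) (T : {set {set 'I_n}}).
Hypothesis tilingT : is_tiling T.
Local Notation half_edge := (half_edge T).
Implicit Types g h p q : half_edge.
Local Notation le := (@half_edge_le n T).
Local Notation sg := (@opp_half_edge n T).
Let G := half_edge_gluing tilingT.

Lemma half_edge_vertex_subproof h : diagonal_of (val h) \in T.
Proof. by have := valP h; rewrite inE. Qed.

Definition half_edge_vertex h : quiver_vertex T :=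
  Sub (diagonal_of (val h)) (half_edge_vertex_subproof h).
Local Notation vert := half_edge_vertex.

Lemma half_edge_vertexP h g : vert h = vert g <-> g = h \/ g = sg h.
Proof.
split=> [/(congr1 val) /= /diagonal_of_eq[e|e]|[->//|->]].
- by left; apply: val_inj.
- by right; apply: val_inj.
by apply: val_inj; rewrite /= diagonal_of_opp.
Qed.

Lemma half_edge_vertex_sg h : vert (sg h) = vert h.
Proof. by symmetry; apply/half_edge_vertexP; right. Qed.

(** Otherwise a side would be adjacent to its own opposite. This makes the two arrows of a relation
    pass through the middle diagonal by the same half-edge. *)
Lemma tile_at_opp s g : s \in sides T -> val g \in tile_at T s ->
  val (sg g) \notin tile_at T s.
Proof.
move=> sT gs; apply/negP => ogs; have gT := valP g.
have : val (sg g) \in tile_at T (val g).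
  by rewrite (tile_at_eq tilingT sT gs).
move=> /(tile_at_adjacent tilingT gT); case=> [|_]; last by rewrite eqxx.
by apply/eqP => /val_inj/eqP; rewrite (sg_neq G).
Qed.

Lemma arrowE (v w : quiver_vertex T) : quiver_arrow v w <->
  exists h p, [/\ covers le h p, v = vert h & w = vert p].
Proof.
split=> [/existsP[t /andP[/imsetP[s sT ->] /(arrow_tile_step tilingT sT)]]|].
  move=> [h [h' [hh' _ _ vE wE]]]; exists h, (sg h'); split=> //;
    apply: val_inj => //=.
  by rewrite diagonal_of_opp.
move=> [h [p [hp -> ->]]]; apply/existsP; exists (tile_at T (val h)).
rewrite imset_f ?(valP h) //= -(diagonal_of_opp (val p)).
by apply: (tile_step_arrow tilingT (h' := sg p));
  rewrite /tile_step (gluing_sgK G).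
Qed.

Lemma same_tile_compositionE (u v w : quiver_vertex T) :
  same_tile_composition u v w <-> exists h p q,
    [/\ covers le h p, covers le (sg p) q, u = vert h, v = vert p & w = vert q].
Proof.
split=> [/existsP[t /andP[/imsetP[s sT ->] /andP[]]]|].
  move=> /(arrow_tile_step tilingT sT)[h [p [hp hs ps uE vE]]].
  move=> /(arrow_tile_step tilingT sT)[p' [q [pq p's qs vE' wE]]].
  have pE : p' = p.
    have : diagonal_of (val p) = diagonal_of (val p') by rewrite -vE.
    case/diagonal_of_eq => [/val_inj//|e].
    by have := tile_at_opp sT ps; rewrite /= -e p's.
  rewrite pE in pq; exists h, (sg p), (sg q);
    rewrite !half_edge_vertex_sg (gluing_sgK G).
  by split=> //; apply: val_inj.
move=> [h [p [q [hp pq -> -> ->]]]]; apply/existsP; exists (tile_at T (val h)).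
rewrite imset_f ?(valP h) //=.
have hp' : tile_step sg le h (sg p) by rewrite /tile_step (gluing_sgK G).
have pq' : tile_step sg le (sg p) (sg q) by rewrite /tile_step (gluing_sgK G).
have a1 := tile_step_arrow tilingT hp'; have a2 := tile_step_arrow tilingT pq'.
rewrite (tile_at_eq tilingT (valP h) (tile_step_at tilingT hp')) in a2.
by move: a1 a2; rewrite /= !diagonal_of_opp => -> ->.
Qed.

(** If [h'] were opposite to [h], the diagonal of [p] would meet both end points of [h], so that
    [p = h] or the end points of [h] coincide. *)
Lemma half_edge_arrow_uniq h p h' p' : covers le h p -> covers le h' p' ->
  vert h = vert h' -> vert p = vert p' -> h = h'.
Proof.
move=> hp hp' /half_edge_vertexP[//|h'E] /half_edge_vertexP p'E; exfalso.
have /andP[/eqP e1 _] := covers_le hp; have /andP[/eqP e2 _] := covers_le hp'.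
have hn := half_edge_neq tilingT h.
case: p'E => p'E; move: e2; rewrite h'E p'E /= => e2.
  by move: hn; rewrite -e1 e2 eqxx.
case/eqP: (covers_neq hp); apply: val_inj.
by rewrite [val p]surjective_pairing [val h]surjective_pairing e1 e2.
Qed.

Lemma tiling_gluing_quiver : gluing_quiver sg le vert (@quiver_arrow n T)
  (fun u v w => same_tile_composition u v w).
Proof.
split.
- exact: half_edge_vertexP.
- move=> v; have [a [b vE]] : exists a b, val v = [set a; b].
    move/forallP: tilingT => /(_ (val v));
      rewrite (valP v) => /andP[/cards2P c2 _].
    by case: c2 => a [b [_ vE]]; exists a, b.
  have abT : (a, b) \in sides T by rewrite inE /= -vE (valP v).
  by exists (Sub (a, b) abT : half_edge); apply: val_inj.
- exact: arrowE.
- exact: half_edge_arrow_uniq.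
- exact: same_tile_compositionE.
Qed.

End TilingQuiver.

Local Close Scope ring_scope.

Theorem lemma4p3 (K : closedFieldType) (n : nat) (T : {set {set 'I_n}}) :
  1 < n ->
  is_tiling T ->
  connected_ring (tiling_algebra K T) ->
  (exists2 t, t \in tiles T & open_tile t && (2 <= tile_length t)) ->
  gorenstein_dimension (tiling_algebra K T) (max_open_length T - 1).
Proof.
move=> _ tilingT conn [t tT /andP[ot lt]].
have G := half_edge_gluing tilingT.
have C := quiver_coordinates K G (tiling_gluing_quiver tilingT).
have k1 : (1 < max_open_length T)%N.
  apply: leq_trans lt _; apply: (leq_bigmax_cond (F := @tile_length n)).
  by rewrite tT.
apply: (gorenstein_dimension_gluing G C k1); first exact: boundary_walk_bound.
apply: maximal_walk => // A Asg.
(* Half-edges of one chain start at the same marked point, so this predicate is constant on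
   chains. *)
apply: (connected_gluing (B := fun g => A (val g).1) G C conn) => [g|h u
  /andP[/eqP -> _] //].
by rewrite /= -Asg.
Qed.
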